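(* Let $(X,\mathscr{A},\mu,T)$ and $(Y,\mathscr{B},\nu,S)$ be two dynamical systems. Then there always exists a maximum $T$-factor $\sigma$-algebra of $S$, denoted by $\mathscr{F}_T$ (that is, a $T$-factor $\sigma$-algebra of $S$ which contains, modulo $\nu$, every $T$-factor $\sigma$-algebra of $S$). Moreover, under any joining $\lambda$ of $T$ and $S$, the $\sigma$-algebras $\mathscr{A}\otimes\{\emptyset,Y\}$ and $\{\emptyset,X\}\otimes\mathscr{B}$ are independent conditionally to the $\sigma$-algebra $\{\emptyset,X\}\otimes\mathscr{F}_T$.
   Context: A dynamical system $(X,\mathscr{A},\mu,T)$ consists of a Lebesgue space (equivalently, a standard Borel space with a probability measure $\mu$) and an automorphism $T$ of it: $T$ is an invertible bi-measurable transformation preserving $\mu$. Measurable sets are identified when they differ by a null set. A joining of $T$ and $S$ is a probability measure on $X\times Y$ with marginals $\mu$ and $\nu$, invariant under $T\times S$. More generally, a joining of a finite or countable family of systems $(T_i)_{i\in I}$ is a probability measure on the product space, invariant under the product transformation, whose marginal on each coordinate is the corresponding invariant measure; it defines a dynamical system. A system $(Z,\mathscr{C},\rho,R)$ is a factor of $(Y,\mathscr{B},\nu,S)$ if there is a homomorphism $\pi:Y\to Z$, i.e. a measurable map with $\pi(\nu)=\rho$ and $\pi\circ S=R\circ\pi$; the associated factor $\sigma$-algebra is $\pi^{-1}(\mathscr{C})$. Factor $\sigma$-algebras of $S$ are, modulo $\nu$, exactly the sub-$\sigma$-algebras of $\mathscr{B}$ invariant under $S$ and $S^{-1}$. A $T$-factor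 of $S$ is any common factor of $S$ with a joining of countably many copies of $T$ (i.e. a system which is a factor of $S$ and also a factor of the system defined by some joining of a countable family of copies of $T$). A $T$-factor $\sigma$-algebra of $S$ is any factor $\sigma$-algebra of $S$ associated to a $T$-factor of $S$. *)

(* Defs.v *)
From HB Require Import structures.
From mathcomp Require Import all_boot all_order all_algebra.
From mathcomp Require Import all_classical all_reals all_analysis.

Set Implicit Arguments.
Unset Strict Implicit.
Unset Printing Implicit Defensive.

Import Order.TTheory GRing.Theory Num.Theory.
Import numFieldNormedType.Exports.

Local Open Scope classical_set_scope.
Local Open Scope ring_scope.

Definition bimeasurable d1 d2 (X : measurableType d1) (Y : measurableType d2)
    (f : X -> Y) : Prop :=
  measurable_fun setT f /\
  exists g : Y -> X, [/\ cancel f g, cancel g f & measurable_fun setT g].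

(* A Hausdorff complete pseudometric type is a complete metric space, so [P]
   ranges over the Polish spaces. *)
Definition standard_borel (R : realType) d (X : measurableType d) : Prop :=
  exists P : completePseudoMetricType R,
    [/\ hausdorff_space P,
        exists2 D : set P, countable D & dense D &
        exists f : X -> g_sigma_algebraType (@open P), bimeasurable f].

Definition measure_preserving (R : realType) d1 d2
    (X : measurableType d1) (Y : measurableType d2)
    (mu : probability X R) (nu : probability Y R) (f : X -> Y) : Prop :=
  measurable_fun setT f /\
  forall A, measurable A -> pushforward mu f A = nu A.

Definition dynamical_system (R : realType) d (X : measurableType d)
    (mu : probability X R) (T : X -> X) : Prop :=
  [/\ standard_borel R X, bimeasurable T & measure_preserving mu mu T].

Definition prod_map (X Y : Type) (T : X -> X) (S : Y -> Y) (p : X * Y) : X * Y :=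
  (T p.1, S p.2).

Definition joining (R : realType) d1 d2
    (X : measurableType d1) (Y : measurableType d2)
    (mu : probability X R) (T : X -> X) (nu : probability Y R) (S : Y -> Y)
    (lambda : probability (X * Y)%type R) : Prop :=
  [/\ measure_preserving lambda mu fst,
      measure_preserving lambda nu snd &
      measure_preserving lambda lambda (prod_map T S)].

Definition cylinders (I : Type) d (X : measurableType d) : set (set (I -> X)) :=
  [set C | exists i A, measurable A /\ C = (fun x => x i) @^-1` A].

Notation power I X := (g_sigma_algebraType (@cylinders I _ X)).

Definition power_map (I X : Type) (T : X -> X) (x : I -> X) : I -> X :=
  fun i => T (x i).

Definition self_joining (R : realType) (I : Type) d (X : measurableType d)
    (mu : probability X R) (T : X -> X)
    (lambda : probability (power I X) R) : Prop :=
  (forall i : I, measure_preserving lambda mu (fun x : power I X => x i)) /\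
  measure_preserving lambda lambda (power_map T : power I X -> power I X).

(* Equivariance is required almost everywhere, as sets and maps are identified
   when they agree up to a null set. *)
Definition homomorphism (R : realType) d1 d2
    (Y : measurableType d1) (Z : measurableType d2)
    (nu : probability Y R) (S : Y -> Y) (rho : probability Z R) (U : Z -> Z)
    (pi : Y -> Z) : Prop :=
  measure_preserving nu rho pi /\ {ae nu, forall y, pi (S y) = U (pi y)}.

Definition is_factor (R : realType) d1 d2
    (Z : measurableType d2) (rho : probability Z R) (U : Z -> Z)
    (Y : measurableType d1) (nu : probability Y R) (S : Y -> Y) : Prop :=
  exists pi : Y -> Z, homomorphism nu S rho U pi.

Definition T_factor (R : realType) dX dY dZ
    (X : measurableType dX) (mu : probability X R) (T : X -> X)
    (Y : measurableType dY) (nu : probability Y R) (S : Y -> Y)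
    (Z : measurableType dZ) (rho : probability Z R) (U : Z -> Z) : Prop :=
  [/\ dynamical_system rho U,
      is_factor rho U nu S &
      exists (I : countType) (lambda : probability (power I X) R),
        self_joining mu T lambda /\ is_factor rho U lambda (power_map T)].

Definition T_factor_algebra (R : realType) dX dY
    (X : measurableType dX) (mu : probability X R) (T : X -> X)
    (Y : measurableType dY) (nu : probability Y R) (S : Y -> Y)
    (F : set (set Y)) : Prop :=
  exists dZ (Z : measurableType dZ) (rho : probability Z R) (U : Z -> Z)
         (pi : Y -> Z),
    [/\ T_factor mu T nu S rho U,
        homomorphism nu S rho U pi &
        F = g_sigma_algebra_preimage pi].

Definition subset_mod (R : realType) d (Y : measurableType d)
    (nu : probability Y R) (G F : set (set Y)) : Prop :=
  forall A, G A -> exists2 B, F B & nu (A `+` B) = 0%E.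

Definition max_T_factor_algebra (R : realType) dX dY
    (X : measurableType dX) (mu : probability X R) (T : X -> X)
    (Y : measurableType dY) (nu : probability Y R) (S : Y -> Y)
    (F : set (set Y)) : Prop :=
  T_factor_algebra mu T nu S F /\
  forall G, T_factor_algebra mu T nu S G -> subset_mod nu G F.

(* [f] is a version of the conditional probability P(A | G). *)
Definition cond_prob (R : realType) d (W : measurableType d)
    (P : probability W R) (G : set (set W)) (A : set W) (f : W -> R) : Prop :=
  [/\ forall B : set R, measurable B -> G (f @^-1` B),
      P.-integrable setT (EFin \o f) &
      forall C, G C -> (\int[P]_(w in C) (f w)%:E = P (A `&` C))%E].

(* P(A `&` B | G) = P(A | G) P(B | G) almost surely. *)
Definition cond_independent (R : realType) d (W : measurableType d)
    (P : probability W R) (FA FB G : set (set W)) : Prop :=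
  forall A B, FA A -> FB B ->
    exists f g h : W -> R,
      [/\ cond_prob P G A f, cond_prob P G B g, cond_prob P G (A `&` B) h &
          {ae P, forall w, h w = f w * g w}].

(* Main.v *)
Require Import Defs.
From HB Require Import structures.
From mathcomp Require Import all_boot all_order all_algebra.
From mathcomp Require Import all_classical all_reals all_analysis.
From mathcomp Require Import measurable_realfun ring lra.

Set Implicit Arguments.
Unset Strict Implicit.
Unset Printing Implicit Defensive.

Import Order.TTheory GRing.Theory Num.Theory.
Import numFieldNormedType.Exports.

Local Open Scope classical_set_scope.
Local Open Scope ring_scope.

(** Call an event B of Y a T-event when, in some joining of S with a joining of
countably many copies of T, it coincides almost surely with an event of the
copies of T. The theorem follows from four facts about T-events.

(1) Every member of a T-factor algebra is a T-event [factor_T_event]. If Z is a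
common factor of S and of a joining lambda of copies of T, then in the
relatively independent joining of lambda and S over Z the two projections to Z
agree almost surely, hence so do the two preimages of any event of Z.

(2) Countably many T-events lie in a single T-factor algebra
[factor_of_events]. The joinings that witness them are glued together
relatively independently over S [common_joining], so that one joining serves
all of them. In it, the visits of the S-orbit to the events B n are recorded by
a map from Y to the shift on the binary arrays indexed by an integer time and by
n, and the visits of the orbit of the copies of T to the corresponding events by a map to
the same shift. Both maps are equivariant and they agree almost surely, so they
exhibit the shift, with their common law, as a T-factor.

(3) The measure algebra of a standard Borel probability space is separable
[countable_approx]. Choose countably many T-events approximating all T-events
and put them in one T-factor algebra by (2): an event that is approximated at
the speed of the powers of 1/2 is, up to a null set, the upper limit of its
approximants [limsup_approx], so this algebra contains every T-event modulo nu.
By (1) it is the maximum.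

(4) For a joining lam of T and S and an event A of X, let f be the conditional
probability of A given Y. In the relatively independent joining of infinitely
many copies of lam over Y, the X-coordinates are, given y, independent and visit
A with probability f y. By the law of large numbers f is almost surely a
function of these coordinates, so its level sets are T-events
[cond_prob_events]. By (2) and maximality they belong to F_T modulo nu;
therefore f is F_T-measurable modulo nu, which says that P(A | Y) = P(A | F_T),
and this gives the conditional independence
[max_T_factor_cond_independent].

All joinings are produced in one way, which replaces disintegration of
measures: a joining of a standard Borel V with Y is the law of (q (y, u), y),
where y has law nu and u is an independent uniform noise [sampler]. For this V
is coded by binary sequences [standard_borel_retract], and the conditional
densities of the cylinder sets give nested subdivisions of [0, 1) in which u is
located. A single noise contains infinitely many independent ones [iid_noise],
so gluing amounts to feeding independent noises to the samplers. A glued law is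
invariant because conditional laws of an invariant law are equivariant almost
everywhere [kern_equivariant]. *)

(** * Measurable maps, laws and almost sure statements *)

Lemma half_pow_gt0 (R : realType) k : 0 < 2 ^- k :> R.
Proof. by rewrite invr_gt0 exprn_gt0. Qed.

Lemma half_pow_small (R : realType) (e : R) : 0 < e -> exists k, 2 ^- k < e.
Proof.
move=> e0; exists (Num.truncn e^-1).
rewrite -[ltRHS]invrK ltf_pV2 ?posrE ?invr_gt0 ?exprn_gt0//.
have /lt_le_trans := @truncnS_gt R e^-1; apply.
by rewrite -natrX ler_nat; exact: ltn_expl.
Qed.

Lemma measurable_preimage d1 d2 (V : measurableType d1) (W : measurableType d2)
    (f : V -> W) (A : set W) :
  measurable_fun setT f -> measurable A -> measurable (f @^-1` A).
Proof. by move=> mf mA; rewrite -[X in measurable X]setTI; exact: mf. Qed.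

Lemma measurable_fun_nat d (W : measurableType d) (f : W -> nat) :
  (forall n, measurable [set w | f w = n]) -> measurable_fun setT f.
Proof.
move=> mf _ A _; rewrite setTI.
have -> : f @^-1` A = \bigcup_(n in A) [set w | f w = n].
  by apply/seteqP; split=> w /=; [move=> Aw; exists (f w)|case=> n An ->].
exact: bigcup_measurable.
Qed.

Lemma measurable_nat2 d (W : measurableType d) (f g : W -> nat)
    (Q : nat -> nat -> Prop) :
  measurable_fun setT f -> measurable_fun setT g ->
  measurable [set w | Q (f w) (g w)].
Proof.
move=> mf mg.
have -> : [set w | Q (f w) (g w)] =
    \bigcup_n ([set w | f w = n] `&` g @^-1` [set m | Q n m]).
  apply/seteqP; split=> w /=; first by move=> q; exists (f w).
  by case=> n _ [/= ->].
apply: bigcupT_measurable => n; apply: measurableI.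
  exact: (measurable_preimage (A := [set n]) mf).
exact: (measurable_preimage (A := [set m | Q n m]) mg).
Qed.

Lemma measurable_bool_set d (W : measurableType d) (f : W -> bool) :
  measurable_fun setT f -> measurable [set w | f w].
Proof.
move=> mf; rewrite (_ : [set w | f w] = f @^-1` [set true]); last by apply/seteqP; split=> w.
exact: measurable_preimage.
Qed.

Lemma measurable_iff d (W : measurableType d) (A B : set W) :
  measurable A -> measurable B -> measurable [set w | A w <-> B w].
Proof.
move=> mA mB; rewrite (_ : [set w | _] = (A `&` B) `|` (~` A `&` ~` B)).
  by apply: measurableU; apply: measurableI => //; exact: measurableC.
apply/seteqP; split=> w /=; last by tauto.
by have [|] := pselect (A w); tauto.
Qed.

Lemma measurable_prod_map d1 d2 d3 d4 (U : measurableType d1) (U' : measurableType d2)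
    (V : measurableType d3) (V' : measurableType d4) (f : U -> U') (g : V -> V') :
  measurable_fun setT f -> measurable_fun setT g ->
  measurable_fun setT (fun x : U * V => (f x.1, g x.2)).
Proof.
move=> mf mg; apply: measurable_fun_pair.
  exact: (measurableT_comp mf measurable_fst).
exact: (measurableT_comp mg measurable_snd).
Qed.

Lemma measurable_power_proj (I : Type) d (X : measurableType d) (i : I) :
  measurable_fun setT (fun x : power I X => x i).
Proof.
move=> _ A mA; rewrite setTI; apply: sub_sigma_algebra.
by exists i, A.
Qed.

Lemma measurable_power (I : Type) dW (W : measurableType dW)
    d (X : measurableType d) (f : W -> power I X) :
  (forall i, measurable_fun setT (fun w => f w i)) -> measurable_fun setT f.
Proof.
move=> mf; apply: (@measurability _ _ W (power I X) setT f (@cylinders I d X)) => //.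
by move=> _ [_ [i [A [mA ->]]] <-]; exact: (mf i).
Qed.

Section law.
Context d1 d2 (W : measurableType d1) (V : measurableType d2) (R : realType).
Variables (Q : probability W R) (f : W -> V) (mf : measurable_fun setT f).

(** The measurability proof is an argument so that the measure structure can be
inferred from the shape of the term. *)
Definition law_fun (_ : measurable_fun setT f) : set V -> \bar R := pushforward Q f.

Let law0 : law_fun mf set0 = 0%E.
Proof. by rewrite /law_fun /pushforward preimage_set0 measure0. Qed.

Let law_ge0 A : (0 <= law_fun mf A)%E.
Proof. exact: measure_ge0. Qed.

Let law_sigma_additive : semi_sigma_additive (law_fun mf).
Proof.
move=> F mF tF mUF; rewrite /law_fun /pushforward preimage_bigcup.
apply: measure_semi_sigma_additive.
- by move=> n; exact: measurable_preimage.
- apply/trivIsetP => /= i j _ _ ij; rewrite -preimage_setI.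
  by move/trivIsetP : tF => /(_ _ _ _ _ ij) ->//; rewrite preimage_set0.
- by rewrite -preimage_bigcup; exact: measurable_preimage.
Qed.

HB.instance Definition _ :=
  isMeasure.Build _ _ _ (law_fun mf) law0 law_ge0 law_sigma_additive.

Let law_setT : law_fun mf setT = 1%E.
Proof. by rewrite /law_fun /pushforward preimage_setT probability_setT. Qed.

HB.instance Definition _ := Measure_isProbability.Build _ _ _ (law_fun mf) law_setT.

Definition law : probability V R := law_fun mf.

Lemma lawE A : law A = Q (f @^-1` A).
Proof. by []. Qed.

Lemma law_preserving : measure_preserving Q law f.
Proof. by split. Qed.

End law.

Lemma preserving_id (R : realType) d (W : measurableType d) (P : probability W R) :
  measure_preserving P P id.
Proof. by split. Qed.

Lemma preserving_comp (R : realType) d1 d2 d3 (U : measurableType d1)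
    (V : measurableType d2) (W : measurableType d3) (P : probability U R)
    (Q : probability V R) (S : probability W R) (f : U -> V) (g : V -> W) :
  measure_preserving P Q f -> measure_preserving Q S g ->
  measure_preserving P S (g \o f).
Proof.
move=> [mf fE] [mg gE]; split; first exact: measurableT_comp.
move=> A mA; rewrite -(gE _ mA) -[RHS]fE//.
exact: measurable_preimage.
Qed.

Lemma preserving_law (R : realType) d1 d2 d3 (U : measurableType d1)
    (V : measurableType d2) (W : measurableType d3) (P : probability U R)
    (Q : probability W R) (f : U -> V) (mf : measurable_fun setT f) (g : V -> W) :
  measurable_fun setT g -> measure_preserving P Q (g \o f) ->
  measure_preserving (law P mf) Q g.
Proof. by move=> mg [_ h]; split => // A mA; rewrite -h. Qed.

Lemma preserving_lawP (R : realType) d1 d2 (U : measurableType d1)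
    (V : measurableType d2) (P : probability U R) (Q : probability V R)
    (f : U -> V) (mf : measurable_fun setT f) :
  (forall E, measurable E -> law P mf E = Q E) -> measure_preserving P Q f.
Proof. by move=> h; split => // E mE; rewrite -h. Qed.

Lemma preserving_inverse (R : realType) d (W : measurableType d)
    (P : probability W R) (f g : W -> W) : cancel g f -> cancel f g ->
  measurable_fun setT g -> measure_preserving P P f -> measure_preserving P P g.
Proof.
move=> gf fg mg [mf hf]; split => // A mA.
rewrite -[RHS](_ : pushforward P f (g @^-1` A) = _); last first.
  by congr (P _); apply/seteqP; split=> w /=; rewrite fg.
by rewrite hf//; exact: measurable_preimage.
Qed.

Lemma ae_forall_count d (W : measurableType d) (R : realType)
    (Q : probability W R) (I : countType) (P : I -> W -> Prop) :
  (forall i, {ae Q, forall w, P i w}) -> {ae Q, forall w, forall i, P i w}.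
Proof.
move=> h; have : {ae Q, forall w, forall n, if unpickle n is Some i then P i w else True}.
  by apply: ae_foralln => n; case: unpickle => [i|]; [exact: h|exact: aeW].
by apply: filterS => w hw i; have := hw (pickle i); rewrite pickleK.
Qed.

Lemma ae_preserving (R : realType) d1 d2 (U : measurableType d1)
    (V : measurableType d2) (P : probability U R) (Q : probability V R)
    (f : U -> V) (H : V -> Prop) : measure_preserving P Q f ->
  {ae Q, forall v, H v} -> {ae P, forall u, H (f u)}.
Proof.
move=> [mf fE] [N [mN N0 HN]]; exists (f @^-1` N); split.
- exact: measurable_preimage.
- by have := fE _ mN; rewrite /pushforward N0.
- by move=> u /= Hu; apply: HN.
Qed.

Lemma ae_law (R : realType) d1 d2 (U : measurableType d1) (V : measurableType d2)
    (P : probability U R) (f : U -> V) (mf : measurable_fun setT f) (H : set V) :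
  measurable H -> {ae P, forall u, H (f u)} -> {ae law P mf, forall v, H v}.
Proof.
move=> mH [N [mN N0 HN]]; exists (~` H); split => //; first exact: measurableC.
have mfH : measurable (f @^-1` (~` H)) by exact: measurable_preimage mf (measurableC mH).
apply/eqP; rewrite eq_le measure_ge0 andbT lawE -N0.
by apply: le_measure; rewrite ?inE.
Qed.

Lemma ae_measure_eq d (W : measurableType d) (R : realType) (P : probability W R)
    (A B : set W) : measurable A -> measurable B ->
  {ae P, forall w, A w <-> B w} -> P A = P B.
Proof.
move=> mA mB h; have le (C D : set W) : measurable C -> measurable D ->
    {ae P, forall w, C w <-> D w} -> (P C <= P D)%E.
  move=> mC mD [N [mN N0 HN]].
  apply: (@le_trans _ _ (P (D `|` N))).
    apply: le_measure; rewrite ?inE//; first exact: measurableU.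
    move=> w Cw; have [Nw|nN] := pselect (N w); [by right|left].
    by apply: contrapT => nD; apply: nN; apply: HN => /= -[/(_ Cw)].
  have : (P (D `|` N) <= P D + P N)%E := measureU2 _ mD mN.
  by rewrite N0 adde0.
apply/eqP; rewrite eq_le !le//.
by apply: filterS h => w; tauto.
Qed.

Lemma probability_setI_full d (W : measurableType d) (R : realType)
    (Q : probability W R) (A F : set W) : measurable A -> measurable F ->
  Q F = 1%E -> Q (A `&` F) = Q A.
Proof.
move=> mA mF QF.
have : (Q A = Q (A `\` F) + Q (A `&` F))%E := measureDI Q mA mF.
suff -> : Q (A `\` F) = 0%E by rewrite add0e => ->.
apply/eqP; rewrite eq_le measure_ge0 andbT.
have <- : Q (~` F) = 0%E by rewrite probability_setC// QF subee.
apply: le_measure; rewrite ?inE//; first exact: measurableD.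
  exact: measurableC.
Qed.

(** This is the Borel-Cantelli lemma: the bounds are summable. *)
Lemma eventually_notin d (W : measurableType d) (R : realType)
    (P : probability W R) (F : nat -> set W) :
  (forall k, measurable (F k)) -> (forall k, (P (F k) <= (2 ^- k)%:E)%E) ->
  {ae P, forall w, exists K, forall k, (K <= k)%N -> ~ F k w}.
Proof.
move=> mF PF; have : P (lim_sup_set F) = 0%E.
  apply: lim_sup_set_cvg0 => //.
  apply: (@le_lt_trans _ _ (\sum_(k <oo) (2 / (2 ^ k.+1)%:R)%:E)%E).
    apply: lee_nneseries => // k _; apply: (le_trans (PF k)).
    by rewrite lee_fin expnS natrM invfM mulrA divff// mul1r natrX.
  by apply: le_lt_trans (ltry 2); exact: (@epsilon_trick0 R 2 xpredT).
move=> L0; exists (lim_sup_set F); split => //.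
  by apply: bigcapT_measurable => n; apply: bigcup_measurable.
move=> w /= h K _; apply: contrapT => nF; apply: h; exists K => k Kk Fk.
by apply: nF; exists k.
Qed.

Section symdiff.
Local Open Scope ereal_scope.
Context d (W : measurableType d) (R : realType) (P : probability W R).

Lemma measurable_setY (A B : set W) : measurable A -> measurable B -> measurable (A `+` B).
Proof. by move=> mA mB; rewrite setY_def; apply: measurableU; exact: measurableD. Qed.

Lemma prob_le (A B : set W) : measurable A -> measurable B -> A `<=` B -> P A <= P B.
Proof. by move=> mA mB AB; apply: le_measure; rewrite ?inE. Qed.

Lemma prob_leU (A B C : set W) : measurable A -> measurable B -> measurable C ->
  A `<=` B `|` C -> P A <= P B + P C.
Proof.
move=> mA mB mC AB; apply: (le_trans (prob_le mA (measurableU _ _ mB mC) AB)).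
exact: measureU2.
Qed.

Lemma setY_triangle (A B C : set W) : A `+` C `<=` (A `+` B) `|` (B `+` C).
Proof.
move=> x; rewrite !setY_def /=; have [] := pselect (A x); have [] := pselect (B x);
  have [] := pselect (C x); tauto.
Qed.

(** Almost every point leaves the sets [A `+` B k] eventually; such a point lies in
A exactly when it lies in infinitely many of the [B k]. *)
Lemma limsup_approx (A : set W) (B : nat -> set W) :
  measurable A -> (forall k, measurable (B k)) ->
  (forall k, P (A `+` B k) <= (2 ^- k)%:E) -> P (A `+` lim_sup_set B) = 0.
Proof.
move=> mA mB h; have mAB k : measurable (A `+` B k) by exact: measurable_setY.
have mL : measurable (lim_sup_set B).
  by apply: bigcapT_measurable => n; exact: bigcup_measurable.
have [N [mN N0 HN]] := eventually_notin mAB h.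
apply/eqP; rewrite eq_le measure_ge0 andbT -N0.
apply: prob_le => //; first exact: measurable_setY.
move=> x; rewrite setY_def => ABx; apply: HN => -[K hK]; case: ABx => -[].
  move=> Ax; apply => n _; exists (maxn K n); first exact: leq_maxr.
  apply: contrapT => nB; apply: (hK (maxn K n) (leq_maxl _ _)).
  by rewrite setY_def; left.
move=> /(_ K I)[k /= Kk Bk] nA; apply: (hK k Kk).
by rewrite setY_def; right.
Qed.

End symdiff.

(** * Integrals, densities and products *)

Lemma integrable_unit d (Y : measurableType d) (R : realType)
    (nu : probability Y R) (f : Y -> R) : measurable_fun setT f ->
  (forall y, 0 <= f y <= 1) -> nu.-integrable setT (EFin \o f).
Proof.
move=> mf f01; apply: (@le_integrable _ _ _ nu _ measurableT _ (cst 1%E)).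
- exact/measurable_EFinP.
- move=> y _ /=; rewrite normr1 lee_fin; have /andP[f0 f1] := f01 y.
  by rewrite ger0_norm.
- exact: finite_measure_integrable_cst.
Qed.

Lemma integral_preserving (R : realType) d1 d2 (U : measurableType d1)
    (V : measurableType d2) (P : probability U R) (Q : probability V R)
    (f : U -> V) (g : V -> R) C : measure_preserving P Q f -> measurable C ->
  measurable_fun setT g -> (forall v, 0 <= g v) ->
  (\int[Q]_(v in C) (g v)%:E = \int[P]_(u in f @^-1` C) (g (f u))%:E)%E.
Proof.
move=> [mf hf] mC mg g0.
transitivity (\int[pushforward P f]_(v in C) (g v)%:E)%E.
  by apply: eq_measure_integral => A mA _; exact/esym/hf.
rewrite (@ge0_integral_pushforward _ _ _ _ _ f mf P C (EFin \o g))//.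
  exact/measurable_EFinP/measurable_funTS.
by move=> v _; rewrite lee_fin.
Qed.

Lemma integral_mrestr d (W : measurableType d) (R : realType)
    (Q : probability W R) (E D : set W) (mE : measurable E) (f : W -> R) :
  measurable D -> measurable_fun setT f -> (forall w, 0 <= f w) ->
  (\int[mrestr Q mE]_(w in D) (f w)%:E = \int[Q]_(w in E `&` D) (f w)%:E)%E.
Proof.
move=> mD mf f0; have mED : measurable (E `&` D) by exact: measurableI.
have mDE : measurable (D `\` E) by exact: measurableD.
have mf' A : measurable_fun A (fun w => (f w)%:E).
  exact/measurable_EFinP/measurable_funTS.
rewrite -{1}(setUIDK D E) (setIC D E) ge0_integral_setU//=; last first.
- by apply/disj_setPS => w [[Ew _] [_ nE]].
- by move=> w _; rewrite lee_fin.
rewrite [X in (_ + X)%E](_ : _ = 0%E) ?adde0; last first.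
  apply: null_set_integral => //.
  by rewrite /= /mrestr setDE -setIA setICl setI0 measure0.
apply: eq_measure_integral => A mA AED; rewrite /= /mrestr; congr (Q _).
by apply/seteqP; split=> w; [case|move=> Aw; split => //; have [] := AED w Aw].
Qed.

Section density.
Context d1 d2 (W : measurableType d1) (Z : measurableType d2) (R : realType).
Variables (Q : probability W R) (rho : probability Z R) (p : W -> Z).
Hypothesis hp : measure_preserving Q rho p.
Variables (E : set W) (mE : measurable E).

(** The part of the law of p that comes from E. Both proofs are arguments so that
the measure structure can be inferred from the shape of the term. *)
Definition slice (_ : measurable_fun setT p) (_ : measurable E) : set Z -> \bar R :=
  fun C => Q (E `&` p @^-1` C).

Local Notation m := (slice hp.1 mE).

Let slice0 : m set0 = 0%E.
Proof. by rewrite /slice preimage_set0 setI0 measure0. Qed.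

Let slice_ge0 A : (0 <= m A)%E.
Proof. exact: measure_ge0. Qed.

Let slice_sigma_additive : semi_sigma_additive m.
Proof.
move=> F mF tF mUF; rewrite /slice preimage_bigcup setI_bigcupr.
apply: measure_semi_sigma_additive.
- by move=> n; apply: measurableI => //; exact: (measurable_preimage hp.1).
- apply/trivIsetP => /= i j _ _ ij; rewrite setIACA -preimage_setI.
  by move/trivIsetP : tF => /(_ _ _ _ _ ij) ->//; rewrite preimage_set0 setI0.
- rewrite -setI_bigcupr -preimage_bigcup; apply: measurableI => //.
  exact: (measurable_preimage hp.1).
Qed.

HB.instance Definition _ :=
  isMeasure.Build _ _ _ m slice0 slice_ge0 slice_sigma_additive.

Let slice_fin : fin_num_fun m.
Proof.
move=> A mA; rewrite ge0_fin_numE// /slice.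
apply: le_lt_trans (ltry 1); apply: probability_le1; apply: measurableI => //.
exact: (measurable_preimage hp.1).
Qed.

HB.instance Definition _ := @Measure_isFinite.Build _ _ _ m slice_fin.

(** The density g of [slice] with respect to rho, given by the Radon-Nikodym
theorem, is the conditional probability of E given p, read on Z instead of W.
The last clause is what allows two conditional probabilities to be multiplied. *)
Lemma cond_density : exists g : Z -> R,
  [/\ measurable_fun setT g, forall z, 0 <= g z, rho.-integrable setT (EFin \o g),
      forall C, measurable C ->
        (\int[rho]_(z in C) (g z)%:E = Q (E `&` p @^-1` C))%E &
      forall (f : Z -> R) C, measurable_fun setT f -> (forall z, 0 <= f z) ->
        measurable C -> (\int[rho]_(z in C) (f z * g z)%:E =
                         \int[Q]_(w in E `&` p @^-1` C) (f (p w))%:E)%E].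
Proof.
have dom : m `<< rho.
  apply/null_content_dominatesP => A mA rA; apply/eqP; rewrite eq_le measure_ge0 andbT.
  apply: (@le_trans _ _ (rho A)); last by rewrite rA.
  rewrite -(hp.2 _ mA); apply: le_measure; rewrite ?inE//.
  - by apply: measurableI => //; exact: (measurable_preimage hp.1).
  - exact: (measurable_preimage hp.1).
pose f := Radon_Nikodym_SigmaFinite.f m rho.
have f0 := Radon_Nikodym_SigmaFinite.f_ge0 dom.
have ffin := Radon_Nikodym_SigmaFinite.f_fin_num dom.
have fint := Radon_Nikodym_SigmaFinite.f_integrable dom.
have fE := Radon_Nikodym_SigmaFinite.f_integral dom.
exists (fine \o f); have fineE : EFin \o (fine \o f) = f.
  by apply/funext => z /=; rewrite fineK.
split.
- apply: measurableT_comp => //; exact: measurable_int fint.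
- by move=> z /=; rewrite fine_ge0.
- by rewrite fineE.
- move=> C mC; transitivity (\int[rho]_(z in C) f z)%E; last exact/esym/fE.
  by apply: eq_integral => z _ /=; rewrite fineK.
- move=> h C mh h0 mC.
  have mpC : measurable (p @^-1` C) by exact: measurable_preimage hp.1 mC.
  transitivity (\int[m]_(z in C) (h z)%:E)%E.
    rewrite -(Radon_Nikodym_SigmaFinite.change_of_variables dom)//.
    - by apply: eq_integral => z _; rewrite EFinM /= fineK.
    - exact/measurable_EFinP/measurable_funTS.
  rewrite -(integral_mrestr Q mE mpC (measurableT_comp mh hp.1))//=.
  transitivity (\int[pushforward (mrestr Q mE) p]_(z in C) (h z)%:E)%E.
    apply: eq_measure_integral => [|A mA _]; first exact: hp.1.
    by rewrite /= /slice /pushforward /mrestr setIC.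
  rewrite (@ge0_integral_pushforward _ _ _ _ _ p hp.1 _ C (EFin \o h))//.
    exact/measurable_EFinP/measurable_funTS.
  by move=> z _; rewrite lee_fin.
Qed.

End density.

Lemma ae_eq_density d (Z : measurableType d) (R : realType) (rho : probability Z R)
    (f g : Z -> R) : rho.-integrable setT (EFin \o f) -> measurable_fun setT g ->
  (forall C, measurable C ->
    (\int[rho]_(z in C) (f z)%:E = \int[rho]_(z in C) (g z)%:E)%E) ->
  {ae rho, forall z, f z = g z}.
Proof.
move=> fi mg fg.
have : ae_eq rho setT (EFin \o f) (EFin \o g).
  by apply: integral_ae_eq => //; [exact/measurable_EFinP|move=> C _; exact: fg].
by apply: filterS => z /(_ I) [].
Qed.

(** Rectangles whose first side runs over a generating pi-system form themselves a
generating pi-system of the product. The first sides will be cylinders or boxes,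
on which the laws below are computed directly. *)
Lemma prob_prod_unique d1 d2 (A : measurableType d1) (B : measurableType d2)
    (R : realType) (GA : set (set A)) (M1 M2 : probability (A * B)%type R) :
  @measurable _ A = <<s GA >> -> setI_closed GA -> GA setT ->
  (forall a b, GA a -> measurable b -> M1 (a `*` b) = M2 (a `*` b)) ->
  forall E, measurable E -> M1 E = M2 E.
Proof.
move=> mGA IGA TGA h E mE.
pose G := [set a `*` b | a in GA & b in @measurable _ B].
apply: (measure_unique G (fun=> setT)) => //.
- rewrite eqEsubset; split; last first.
    apply: smallest_sub; first exact: sigma_algebra_measurable.
    move=> _ [a GAa [b mb <-]]; apply: measurableX => //.
    by rewrite mGA; exact: sub_sigma_algebra.
  apply: smallest_sub; first exact: smallest_sigma_algebra.
  rewrite subUset; split.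
    rewrite mGA -g_sigma_preimageE; apply: smallest_sub; first exact: smallest_sigma_algebra.
    move=> _ [a GAa <-]; apply: sub_sigma_algebra.
    by exists a => //; exists setT => //; rewrite setTI -setXT.
  move=> _ [b mb <-]; apply: sub_sigma_algebra.
  by exists setT => //; exists b => //; rewrite setTI -setTX.
- move=> _ _ [a GAa [b mb <-]] [a' GAa' [b' mb' <-]].
  rewrite -setXI; exists (a `&` a'); first exact: IGA.
  by exists (b `&` b') => //; exact: measurableI.
- by move=> _; exists setT => //; exists setT => //; rewrite setXTT.
- by rewrite bigcup_const//; exists 0%N.
- by move=> _ [a GAa [b mb <-]]; exact: h.
- by move=> _; rewrite (le_lt_trans (probability_le1 _ _)) ?ltry.
Qed.

Lemma prob_rect_unique d1 d2 (A : measurableType d1) (B : measurableType d2)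
    (R : realType) (M1 M2 : probability (A * B)%type R) :
  (forall a b, measurable a -> measurable b -> M1 (a `*` b) = M2 (a `*` b)) ->
  forall E, measurable E -> M1 E = M2 E.
Proof.
apply: prob_prod_unique => //; last by move=> ? ?; exact: measurableI.
rewrite eqEsubset; split; first exact: sub_sigma_algebra.
by apply: smallest_sub => //; exact: sigma_algebra_measurable.
Qed.

(** The product measure with the type of a probability, as required by [law] and
[measure_preserving]. *)
Definition pprod d1 d2 (Y : measurableType d1) (Om : measurableType d2)
    (R : realType) (nu : probability Y R) (P : probability Om R) :
  probability (Y * Om)%type R := (nu \x P)%E.

Lemma pprodE d1 d2 (Y : measurableType d1) (Om : measurableType d2)
    (R : realType) (nu : probability Y R) (P : probability Om R) A B :
  measurable A -> measurable B -> pprod nu P (A `*` B) = (nu A * P B)%E.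
Proof. exact: product_measure1E. Qed.

Lemma preserving_fst (R : realType) d1 d2 (U : measurableType d1)
    (V : measurableType d2) (P : probability U R) (Q : probability V R) :
  measure_preserving (pprod P Q) P fst.
Proof.
split; first exact: measurable_fst.
move=> A mA; rewrite /pushforward [X in pprod P Q X](_ : _ = A `*` setT).
  by rewrite pprodE// probability_setT mule1.
by apply/seteqP; split=> [x Ax|x []].
Qed.

Lemma preserving_prod (R : realType) d1 d2 d3 d4 (U : measurableType d1)
    (U' : measurableType d2) (V : measurableType d3) (V' : measurableType d4)
    (P : probability U R) (P' : probability U' R) (Q : probability V R)
    (Q' : probability V' R) (f : U -> U') (g : V -> V') :
  measure_preserving P P' f -> measure_preserving Q Q' g ->
  measure_preserving (pprod P Q) (pprod P' Q') (fun x => (f x.1, g x.2)).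
Proof.
move=> [mf hf] [mg hg].
have m := measurable_prod_map mf mg.
apply: (preserving_lawP (mf := m)) => A mA.
apply: (prob_rect_unique _ mA).
move=> a b ma mb; rewrite lawE [X in pprod P Q X](_ : _ = (f @^-1` a) `*` (g @^-1` b))//.
rewrite !pprodE//.
- by rewrite -hf// -hg.
- exact: measurable_preimage.
- exact: measurable_preimage.
Qed.

Section fiber.
Context d1 d2 (Y : measurableType d1) (Om : measurableType d2) (R : realType).
Variables (nu : probability Y R) (P : probability Om R) (F : set (Y * Om)).
Hypothesis mF : measurable F.

Let fiberE y : xsection F y = [set u | F (y, u)].
Proof. by apply/seteqP; split=> u /xsectionP. Qed.

Lemma measurable_fiber y : measurable [set u | F (y, u)].
Proof. by rewrite -fiberE; exact: measurable_xsection. Qed.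

Lemma measurable_fun_fiber : measurable_fun setT (fun y => P [set u | F (y, u)]).
Proof.
rewrite (_ : (fun y => _) = P \o xsection F); first exact: measurable_fun_xsection.
by apply/funext => y /=; rewrite fiberE.
Qed.

Lemma prod_fiber B : measurable B ->
  (pprod nu P (F `&` fst @^-1` B) = \int[nu]_(y in B) P [set u | F (y, u)])%E.
Proof.
move=> mB; rewrite [RHS]integral_mkcond /pprod /= /product_measure1 /=.
apply: eq_integral => y _ /=; rewrite patchE; case: ifPn => yB.
  congr (P _); apply/seteqP; split=> u.
    by move/xsectionP => [].
  by move=> Fyu; apply/xsectionP; split => //; exact: set_mem.
rewrite -[RHS](measure0 P); congr (P _).
apply/seteqP; split=> // u /xsectionP[_ /= By].
by move/negP : yB; apply; exact: mem_set.
Qed.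

End fiber.

(** * Standard Borel spaces are coded by binary sequences *)

Notation bits := (power nat bool).

(** Being a measurable retract of the space of binary sequences is all that is
needed of a standard Borel space. Unlike an isomorphism with a space of sequences
it leaves the image of the coding arbitrary, and it passes to countable products. *)
Definition cantor_retract d (V : measurableType d) : Prop :=
  exists (e : V -> bits) (r : bits -> V),
    [/\ measurable_fun setT e, measurable_fun setT r & cancel e r].

Lemma bits_coord n (b : bool) : measurable [set x : bits | x n = b].
Proof. exact: (measurable_preimage (A := [set b]) (@measurable_power_proj nat _ bool n)). Qed.

Section polish.
Variables (R : realType) (P : completePseudoMetricType R).
Hypothesis hP : hausdorff_space P.
Variable s : nat -> P.
Hypothesis ds : dense (range s).

Let rad (k : nat) : R := 2 ^- k.

Let rad_gt0 k : 0 < rad k.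
Proof. exact: half_pow_gt0. Qed.

Let radS k : rad k = rad k.+1 + rad k.+1.
Proof.
rewrite /rad exprS invfM; have : (2 ^- k : R) = 2^-1 * 2 ^- k + 2^-1 * 2 ^- k.
  by field; rewrite expf_neq0.
by [].
Qed.

Let code (x : P) : bits := fun n => `[< (ball (s (odflt (0, 0)%N (unpickle n)).2)
  (rad (odflt (0, 0)%N (unpickle n)).1))° x >].

Definition bit_at (b : bits) (k i : nat) : bool := b (pickle (k, i)).

Definition first_index (b : bits) k : nat :=
  if pselect (exists i, bit_at b k i) is left h then ex_minn h else 0%N.

Let codeP x k i : bit_at (code x) k i -> ball (s i) (rad k) x.
Proof.
by rewrite /bit_at /code pickleK /= => /asboolP; exact: interior_subset.
Qed.

Let code_ex x k : exists i, bit_at (code x) k i.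
Proof.
have [|y [+ [i _ iy]]] := @ds (ball x (rad k.+1))° _ (@open_interior _ (ball x (rad k.+1))).
  by exists x; apply: nbhs_singleton; apply: nbhs_interior; exact: nbhsx_ballx.
rewrite -{y}iy => /interior_subset bx; exists i; rewrite /bit_at /code pickleK /=.
apply/asboolP; apply/nbhs_ballP; exists (rad k.+1) => //= y xy; rewrite radS.
by apply: ball_triangle xy; exact: ball_sym.
Qed.

Let first_code x k : ball (s (first_index (code x) k)) (rad k) x.
Proof.
rewrite /first_index; case: pselect => [h|/(_ (code_ex x k))//].
by case: ex_minnP => i /codeP.
Qed.

Let m_bit k i : measurable [set b | bit_at b k i].
Proof. exact: bits_coord. Qed.

Let m_first k : measurable_fun setT (first_index^~ k).
Proof.
apply: measurable_fun_nat => n.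
have -> : [set b | first_index b k = n] =
    ([set b | bit_at b k n] `&` ~` \bigcup_(j in `I_n) [set b | bit_at b k j]) `|`
    ((if n == 0%N then setT else set0) `&` ~` \bigcup_j [set b | bit_at b k j]).
  apply/seteqP; split=> b /=; rewrite /first_index.
    case: pselect => [h|h <-].
      case: ex_minnP => m bm mmin <-; left; split => // -[j /= jm bj].
      by have := mmin _ bj; rewrite leqNgt jm.
    by right; split => // -[j _ bj]; apply: h; exists j.
  case: pselect => [h|h].
    case: ex_minnP => m bm mmin [[bn hn]|[_ []]]; last by exists m.
    apply/eqP; rewrite eqn_leq mmin//= leqNgt; apply/negP => mn.
    by apply: hn; exists m.
  by case=> [[bn _]|[]]; [case: h; exists n|case: eqP].
apply: measurableU; apply: measurableI; last 2 first.
- by case: eqP.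
- by apply: measurableC; apply: bigcupT_measurable.
- exact: m_bit.
- by apply: measurableC; apply: bigcup_measurable.
Qed.

(** Bit (k, i) of the code of a point tells whether the point is in the interior of
the ball of radius 2^-k around [s i], so [first_index] finds a 2^-k
approximation of it. An arbitrary sequence of bits need not come from a point;
a proposed approximation is followed only if it is close enough to the current
one, which makes the tracked points a Cauchy sequence in every case and
[decode] a total function. On genuine codes no proposal is ever rejected. *)
Fixpoint track (b : bits) k : nat :=
  if k is k'.+1 then
    if `[< ball (s (track b k')) (rad k' + rad k) (s (first_index b k)) >]
    then first_index b k else track b k'
  else first_index b 0.

Let track_code x k : track (code x) k = first_index (code x) k.
Proof.
elim: k => [//|k IH] /=; case: asboolP => // -[]; rewrite IH.
by apply: (ball_triangle (first_code x k)); apply: ball_sym; exact: first_code.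
Qed.

Let track_step b k : ball (s (track b k)) (rad k + rad k.+1) (s (track b k.+1)).
Proof.
rewrite /=; case: asboolP => // _.
by apply: ballxx; rewrite addr_gt0.
Qed.

Let track_near b k j : ball (s (track b k)) (rad k *+ 4) (s (track b (k + j))).
Proof.
suff : ball (s (track b k)) (rad k *+ 4 - rad (k + j) *+ 3) (s (track b (k + j))).
  by apply: le_ball; rewrite lerBlDr lerDl mulrn_wge0// ltW.
elim: j => [|j IH].
  rewrite addn0; apply: ballxx; have := rad_gt0 k; lra.
rewrite addnS; apply: le_ball (ball_triangle IH (track_step b _)).
have := radS (k + j); have := rad_gt0 (k+j).+1; set u := rad (_).+1.
set v := rad (k + j); set w := rad k => u0 ->; lra.
Qed.

Let track_cvg b : cvg ((fun k => s (track b k)) @ \oo).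
Proof.
apply: cauchy_cvg; apply: cauchy_exP => e e0.
have [k] := @half_pow_small R (e / 4) (divr_gt0 e0 (ltr0n _ 4)).
rewrite -/(rad k) => ke.
exists (s (track b k)); exists k => // n /= kn.
by rewrite -(subnKC kn); apply: le_ball (track_near b k _); move: ke; lra.
Qed.

Definition decode (b : bits) : P := lim ((fun k => s (track b k)) @ \oo).

Let decode_near b k : ball (s (track b k)) (rad k *+ 5) (decode b).
Proof.
have /cvg_ballP/(_ _ (rad_gt0 k)) [N _ hN] := @track_cvg b.
have := hN (k + N)%N (leq_addl _ _) => /= /ball_sym h.
by rewrite mulrS addrC; exact: ball_triangle (track_near b k N) h.
Qed.

Let codeK : cancel code decode.
Proof.
move=> x; apply: hP => A B /nbhs_ballP[e e0 eA] /nbhs_ballP[f f0 fB].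
have mf0 : 0 < Num.min e f by rewrite lt_min e0 f0.
have [k] := @half_pow_small R (Num.min e f / 5) (divr_gt0 mf0 (ltr0n _ 5)).
rewrite -/(rad k) => ke.
have tx : ball x (rad k) (s (track (code x) k)).
  by rewrite track_code; apply: ball_sym; exact: first_code.
have td := ball_sym (@decode_near (code x) k).
have [re rf] : rad k *+ 5 < e /\ rad k *+ 5 < f.
  by move: ke; rewrite ltr_pdivlMr// lt_min mulr_natr => /andP.
exists (s (track (code x) k)); split.
  by apply: eA; apply: le_ball td; exact: ltW.
by apply: fB; apply: le_ball tx; have := rad_gt0 k; lra.
Qed.

Let m_track k : measurable_fun setT (track^~ k).
Proof.
elim: k => [|k IH]; first exact: m_first.
apply: measurable_fun_nat => n.
exact: (@measurable_nat2 _ _ (track^~ k) (first_index^~ k.+1)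
  (fun t f => (if `[< ball (s t) (rad k + rad k.+1) (s f) >] then f else t) = n)).
Qed.

Let m_decode U : open U -> measurable (decode @^-1` U).
Proof.
move=> oU.
have -> : decode @^-1` U =
    \bigcup_k [set b | ball (s (track b k)) (rad k *+ 5) `<=` U].
  apply/seteqP; split=> b /=; last first.
    by case=> k _ h; apply: h; exact: decode_near.
  move=> Ub; have /nbhs_ballP[e e0 eU] := open_nbhs_nbhs (conj oU Ub).
  have [k] := @half_pow_small R (e / 10) (divr_gt0 e0 (ltr0n _ 10)).
  rewrite -/(rad k) => ke.
  exists k => // y ty; apply: eU.
  apply: le_ball (ball_triangle (ball_sym (@decode_near b k)) ty).
  by move: ke; lra.
apply: bigcupT_measurable => k.
exact: (measurable_preimage (A := [set t | ball (s t) (rad k *+ 5) `<=` U]) (@m_track k)).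
Qed.

(** The coding tests membership in a countable base. The decoding is measurable
because it is a uniform limit, at a known rate, of functions with countably many
values. *)
Lemma polish_cantor_retract : cantor_retract (g_sigma_algebraType (@open P)).
Proof.
exists code, decode; split; last exact: codeK.
  apply: measurable_power => n; apply: (@measurable_fun_bool _ _ _ _ true).
  rewrite setTI; apply: sub_sigma_algebra.
  rewrite (_ : _ @^-1` _ = (ball (s (odflt (0, 0)%N (unpickle n)).2)
    (rad (odflt (0, 0)%N (unpickle n)).1))°); first exact: open_interior.
  by apply/seteqP; split=> x /= /asboolP.
apply: (@measurability _ _ bits (g_sigma_algebraType (@open P)) setT decode (@open P)) => //.
by move=> _ [U oU <-]; rewrite setTI; exact: m_decode.
Qed.

End polish.

Lemma standard_borel_retract (R : realType) d (X : measurableType d) :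
  standard_borel R X -> cantor_retract X.
Proof.
move=> [P [hP [D cD dD] [f [mf [g [fg gf mg]]]]]].
have [x0 Dx0] : D !=set0.
  have [|x [_ Dx]] := dD setT _ openT; first by exists point.
  by exists x.
have [s sD] : exists s : nat -> P, range s = D.
  have /pcard_surjP[h hs] : (D #<= [set: nat])%card by exact: cD.
  exists (fun n => if `[< D (h n) >] then h n else x0).
  apply/seteqP; split=> [x [n _ <-]|x Dx]; first by case: asboolP.
  have [n _ hn] := hs _ Dx; exists n => //.
  by case: asboolP; rewrite hn.
have ds : dense (range s) by rewrite sD.
have [e [r [me mr er]]] := polish_cantor_retract hP ds.
exists (e \o f), (g \o r); split.
- exact: measurableT_comp.
- exact: measurableT_comp.
- by move=> x /=; rewrite er fg.
Qed.

Lemma cantor_retract_power (I : countType) d (X : measurableType d) :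
  cantor_retract X -> cantor_retract (power I X).
Proof.
move=> [e [r [me mr er]]].
pose E (x : power I X) : bits := fun n =>
  if unpickle n is Some (i, k) then e (x i) k else false.
pose D (b : bits) : power I X := fun i => r (fun k : nat => b (pickle (i, k))).
exists E, D; split.
- apply: measurable_power => n; rewrite /E.
  case: (unpickle n) => [[i k]|]; last exact: measurable_cst.
  have := @measurable_power_proj nat _ bool k.
  move=> /measurableT_comp/(_ me)/measurableT_comp; apply.
  exact: measurable_power_proj.
- apply: measurable_power => i; apply: (measurableT_comp mr).
  apply: measurable_power => k; exact: measurable_power_proj.
- move=> x; apply/funext => i; rewrite /D -[RHS]er; congr r; apply/funext => k.
  by rewrite /E pickleK.
Qed.

Lemma cantor_retract_pair d1 d2 (X : measurableType d1) (Y : measurableType d2) :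
  cantor_retract X -> cantor_retract Y -> cantor_retract (X * Y)%type.
Proof.
move=> [e [r [me mr er]]] [e' [r' [me' mr' er']]].
pose E (x : X * Y) : bits := fun n : nat =>
  if odd n then e x.1 n./2 else e' x.2 n./2.
pose D (b : bits) : X * Y :=
  (r (fun k : nat => b k.*2.+1), r' (fun k : nat => b k.*2)).
exists E, D; split.
- apply: measurable_power => n; rewrite /E; case: odd.
    have := @measurable_power_proj nat _ bool n./2.
    by move=> /measurableT_comp/(_ me)/measurableT_comp; apply.
  have := @measurable_power_proj nat _ bool n./2.
  by move=> /measurableT_comp/(_ me')/measurableT_comp; apply.
- apply: measurable_fun_pair.
    apply: (measurableT_comp mr).
    by apply: measurable_power => k; exact: measurable_power_proj.
  apply: (measurableT_comp mr').
  by apply: measurable_power => k; exact: measurable_power_proj.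
- move=> [x y]; congr (_, _).
    rewrite -[RHS]er; congr r; apply/funext => k.
    by rewrite /E /= odd_double /= uphalf_double.
  rewrite -[RHS]er'; congr r'; apply/funext => k.
  by rewrite /E odd_double doubleK.
Qed.

Lemma standard_borel_real (R : realType) : standard_borel R R.
Proof.
exists R; split; first exact: Rhausdorff.
  exists (range (@ratr R)); last exact: dense_rat.
  by apply: sub_countable (countableP [set: rat]); exact: card_image_le.
exists id; split.
  apply: (@measurability _ _ R (g_sigma_algebraType (@open R)) setT id (@open R)) => //.
  by move=> _ [U oU <-]; rewrite setTI; exact: open_measurable.
exists id; split => //.
apply: (@measurability _ _ (g_sigma_algebraType (@open R)) R setT id
  (@RGenOpens.G R)); first exact: RGenOpens.measurableE.
by move=> _ [_ [x [y ->]] <-]; rewrite setTI; apply: sub_sigma_algebra; exact: interval_open.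
Qed.

(** * Sampling a joining from uniform noise *)

(** The real line carries several measurable structures; this one is the structure
on which the Lebesgue measure and the uniform law are defined. *)
Notation noise R := (measurableTypeR R).

Section sampler.
Context (R : realType).

Definition unif : probability (noise R) R := uniform_prob (@ltr01 R).

Lemma unif_itv (a b : R) : 0 <= a -> a <= b -> b <= 1 ->
  unif `[a, b[%classic = (b - a)%:E.
Proof.
move=> a0 ab b1; rewrite /unif /= /uniform_prob integral_uniform_pdf.
rewrite (_ : _ `&` _ = `[a, b[%classic); last first.
  apply/seteqP; split=> x /=; rewrite !in_itv/=; first by case.
  by move=> /andP[ax xb]; rewrite ax xb (le_trans a0 ax) (ltW (lt_le_trans xb b1)).
rewrite (eq_integral (fun=> 1%:E)); last first.
  move=> x; rewrite inE/= in_itv/= /uniform_pdf => /andP[ax xb].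
  by rewrite (le_trans a0 ax) (ltW (lt_le_trans xb b1))/= subr0 invr1.
rewrite integral_cst//= mul1e lebesgue_measure_itv/= lte_fin.
by case: ltP => // ba; congr EFin; apply/eqP; rewrite eq_sym subr_eq0 eq_le ba ab.
Qed.

Lemma unif_unit : unif `[0, 1[%classic = 1%E.
Proof. by rewrite unif_itv// subr0. Qed.

(** The most recent bit comes first, so that extending a word is a [cons]. *)
Fixpoint pref (x : bits) n : seq bool := if n is n'.+1 then x n' :: pref x n' else [::].

Lemma size_pref x n : size (pref x n) = n.
Proof. by elim: n => //= n ->. Qed.

Definition cyl (t : seq bool) : set bits := [set x | pref x (size t) = t].

Lemma cyl_nil : cyl [::] = setT.
Proof. by apply/seteqP; split. Qed.

Lemma cyl_cons b t : cyl (b :: t) = cyl t `&` [set x | x (size t) = b].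
Proof.
apply/seteqP; split=> x; rewrite /cyl/=; first by move=> [-> ?].
by case=> -> ->.
Qed.

Lemma pref_agree x y m n : (m <= n)%N -> pref x n = pref y n -> pref x m = pref y m.
Proof.
elim: n => [|n IH]; first by rewrite leqn0 => /eqP ->.
by rewrite leq_eqVlt => /predU1P[-> //|]; rewrite ltnS => /IH h /= [_ /h].
Qed.

Lemma cylI s t : (size s <= size t)%N -> cyl s `&` cyl t = cyl t \/ cyl s `&` cyl t = set0.
Proof.
move=> st; have [[x [sx tx]]|h] := pselect (cyl s `&` cyl t !=set0); last first.
  by right; apply/seteqP; split=> // x xx; case: h; exists x.
left; apply/seteqP; split=> y; first by case.
move=> ty; split => //; rewrite /cyl/= -[RHS]sx; apply: (pref_agree st).
by rewrite ty.
Qed.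

Definition cyls : set (set bits) := [set C | C = set0 \/ exists t, C = cyl t].

Lemma cyls_setI : setI_closed cyls.
Proof.
move=> C D [->|[s ->]]; first by left; rewrite set0I.
case=> [->|[t ->]]; first by left; rewrite setI0.
have [st|/ltnW ts] := leqP (size s) (size t).
  by have [->|->] := cylI st; [right; exists t|left].
by rewrite setIC; have [->|->] := cylI ts; [right; exists s|left].
Qed.

Lemma cyls_setT : cyls setT.
Proof. by right; exists [::]; rewrite cyl_nil. Qed.

Lemma measurable_cyl t : measurable (cyl t).
Proof.
elim: t => [|b t IH]; first by rewrite cyl_nil.
by rewrite cyl_cons; apply: measurableI => //; exact: bits_coord.
Qed.

Lemma cyls_gen : @measurable _ bits = <<s cyls >>.
Proof.
rewrite eqEsubset; split; last first.
  apply: smallest_sub; first exact: sigma_algebra_measurable.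
  by move=> _ [->|[t ->]] //; exact: measurable_cyl.
apply: smallest_sub; first exact: smallest_sigma_algebra.
move=> _ [n [A [_ ->]]].
have -> : (fun x : nat -> bool => x n) @^-1` A =
    \bigcup_(t in [set t | size t = n.+1 /\ A (head false t)]) cyl t.
  apply/seteqP; split=> x /=.
    by move=> Ax; exists (pref x n.+1); rewrite /cyl/= ?size_pref.
  by case=> t [st At]; rewrite /cyl/= st => tx; move: At; rewrite -tx.
rewrite bigcup_mkcond.
apply: (@countable_bigcupT_measurable _ (g_sigma_algebraType cyls)) => // t.
case: ifP => _; last exact: measurable0.
by apply: sub_sigma_algebra; right; exists t.
Qed.

Context dY (Y : measurableType dY).

Section walk.
Variable p : seq bool -> Y -> R.
Hypothesis mp : forall t, measurable_fun setT (p t).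

(** When p t is the conditional probability of the cylinder of t, the intervals
[lo t, lo t + p t) of the words of a given length form a subdivision of [0, 1),
and each is cut into those of its two one-bit extensions. *)
Fixpoint lo (t : seq bool) (y : Y) : R :=
  if t is b :: t' then lo t' y + (if b then p (false :: t') y else 0) else 0.

(** This is the word of length n whose interval contains the noise: the next bit is
1 when the noise is beyond the part allotted to 0. *)
Fixpoint word (yu : Y * noise R) n : seq bool :=
  if n is n'.+1 then
    (lo (word yu n') yu.1 + p (false :: word yu n') yu.1 <= yu.2) :: word yu n'
  else [::].

Definition sample (yu : Y * noise R) : bits := fun n => head false (word yu n.+1).

Lemma pref_sample yu n : pref (sample yu) n = word yu n.
Proof. by elim: n => //= n ->. Qed.

Lemma measurable_lo t : measurable_fun setT (lo t).
Proof.
elim: t => [|b t IH]; first exact: measurable_cst.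
by apply: measurable_funD => //; case: b => //; exact: mp.
Qed.

Lemma measurable_word t : measurable [set yu | word yu (size t) = t].
Proof.
elim: t => [|b t IH] /=.
  by rewrite (_ : [set _ | _] = setT)//; apply/seteqP.
have -> : [set yu | (lo (word yu (size t)) yu.1 +
      p (false :: word yu (size t)) yu.1 <= yu.2) :: word yu (size t) = b :: t] =
    [set yu | word yu (size t) = t] `&`
    (fun yu => lo t yu.1 + p (false :: t) yu.1 <= yu.2) @^-1` [set b].
  by apply/seteqP; split=> yu /=; [case=> + e; rewrite e|case=> -> ->].
apply: measurableI => //; apply: measurable_preimage => //.
apply: measurable_fun_ler; last exact: measurable_snd.
apply: measurable_funD.
  exact: (measurableT_comp (measurable_lo t) measurable_fst).
exact: (measurableT_comp (mp (false :: t)) measurable_fst).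
Qed.

Lemma sample_cyl t : sample @^-1` cyl t = [set yu | word yu (size t) = t].
Proof. by apply/seteqP; split=> yu /=; rewrite /cyl/= pref_sample. Qed.

Lemma measurable_sample : measurable_fun setT sample.
Proof.
apply: (@measurability _ _ _ bits setT sample cyls); first exact: cyls_gen.
move=> _ [_ [->|[t ->]] <-]; rewrite setTI; first by rewrite preimage_set0.
by rewrite sample_cyl; exact: measurable_word.
Qed.

(** The identities that hold almost surely for conditional probabilities of
cylinders, under which the intervals above are nested subdivisions. *)
Definition consistent (y : Y) := [/\ p [::] y = 1, forall t, 0 <= p t y &
  forall t, p t y = p (false :: t) y + p (true :: t) y].

Lemma word_itv y u t : consistent y -> 0 <= u < 1 ->
  word (y, u) (size t) = t <-> lo t y <= u < lo t y + p t y.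
Proof.
move=> [p1 p0 pS] u01; elim: t => [|b t IH]; first by rewrite /= p1 add0r.
have := p0 (false :: t); have := p0 (true :: t); have := pS t.
split=> [[+ wt]|].
  move/IH : (wt); rewrite /= wt; case: b => /= wI; first by move=> h; lra.
  by move/negbT; rewrite -ltNge => h; lra.
move=> h; have /IH wt : lo t y <= u < lo t y + p t y.
  by move: h => /=; case: b; lra.
rewrite /= wt; congr (_ :: _); move: h => /=; case: b => h; apply/idP; [lra|].
by apply/negP; rewrite -ltNge; lra.
Qed.

Lemma lo_bounds y t : consistent y -> 0 <= lo t y /\ lo t y + p t y <= 1.
Proof.
move=> [p1 p0 pS]; elim: t => [|b t [IH1 IH2]] /=; first by rewrite p1 add0r.
have := p0 (false :: t); have := p0 (true :: t); have := pS t.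
by case: b => /=; lra.
Qed.

Lemma unif_sample y t : consistent y ->
  unif [set u | cyl t (sample (y, u))] = (p t y)%:E.
Proof.
move=> cy; have [l0 l1] := lo_bounds t cy; have pt := let: And3 _ h _ := cy in h t.
have mE : measurable [set u : noise R | cyl t (sample (y, u))].
  have := measurable_preimage (measurable_fun_pair2 y measurable_sample) (measurable_cyl t).
  exact.
rewrite -[RHS](_ : unif `[lo t y, lo t y + p t y[%classic = _); last first.
  by rewrite unif_itv//; [congr EFin; lra|lra].
have mI (a b : R) : measurable (`[a, b[%classic : set (noise R)) by exact: measurable_itv.
rewrite -(probability_setI_full mE (mI 0 1) unif_unit).
rewrite -[RHS](probability_setI_full (mI _ _) (mI 0 1) unif_unit).
congr (uniform_prob _ _).
apply/seteqP; split=> u /= [h]; rewrite !in_itv/= => u01; split => //.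
  by move: h; rewrite /cyl/= pref_sample => /(word_itv _ cy u01).
by rewrite /cyl/= pref_sample; apply/(word_itv _ cy u01); move: h; rewrite in_itv.
Qed.

End walk.

(** Code V by bits and let p t be the conditional probability, given the point of
Y, of the cylinder of t. Locating the noise in the nested subdivisions with
these lengths produces a sequence of bits whose prefix is t with conditional
probability p t. *)
Lemma sampler dV (V : measurableType dV) (lam : probability (V * Y)%type R)
    (nu : probability Y R) : cantor_retract V -> measure_preserving lam nu snd ->
  exists q : Y * noise R -> V, measurable_fun setT q /\
    measure_preserving (pprod nu unif) lam (fun yu => (q yu, yu.1)).
Proof.
move=> [e [r [me mr er]]] hnu.
pose E t := (e \o fst) @^-1` cyl t : set (V * Y).
have mE t : measurable (E t).
  apply: measurable_preimage; last exact: measurable_cyl.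
  exact: measurableT_comp me measurable_fst.
have /choice[p hp] t := cond_density hnu (mE t).
have mp t : measurable_fun setT (p t) by have [] := hp t.
have ip t : nu.-integrable setT (EFin \o p t) by have [] := hp t.
have pE t C : measurable C -> (\int[nu]_(y in C) (p t y)%:E = lam (E t `&` snd @^-1` C))%E.
  by have [_ _ _ + _] := hp t; apply.
have cp : {ae nu, forall y, consistent p y}.
  have p1 : {ae nu, forall y, p [::] y = 1}.
    apply: ae_eq_density => // C mC; rewrite pE// integral_cst//= mul1e.
    rewrite (_ : E [::] = setT) ?setTI; first exact: hnu.2.
    by rewrite /E cyl_nil preimage_setT.
  have pS : {ae nu, forall y, forall t, p t y = p (false :: t) y + p (true :: t) y}.
    apply: ae_forall_count => t; apply: ae_eq_density => // [|C mC].
      exact: measurable_funD.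
    under [RHS]eq_integral do rewrite EFinD.
    rewrite integralD//=; last 2 first.
    - by apply: (integrableS measurableT) => //; exact: ip.
    - by apply: (integrableS measurableT) => //; exact: ip.
    rewrite !pE// -measureU//=.
    - rewrite -setIUl; congr (lam (_ `&` _)); rewrite /E !cyl_cons.
      by apply/seteqP; split=> -[v y] /=; case: (e v (size t)) => //=; tauto.
    - by apply: measurableI => //; exact: measurable_preimage.
    - by apply: measurableI => //; exact: measurable_preimage.
    - rewrite /E !cyl_cons; apply/seteqP; split=> //= -[v y] /= [[[_ ->] _] [[]]].
      by [].
  apply: filterS2 p1 pS => y y1 yS; split => // t.
  by have [_ + _ _ _] := hp t; apply.
have m1 : measurable_fun setT (fun yu : Y * noise R => (sample p yu, yu.1)).
  by apply: measurable_fun_pair => //; exact: measurable_sample.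
have m2 : measurable_fun setT (fun vy : V * Y => (e vy.1, vy.2)).
  apply: measurable_fun_pair => //.
  exact: (measurableT_comp me measurable_fst).
have key E' : measurable E' -> law (pprod nu unif) m1 E' = law lam m2 E'.
  apply: (prob_prod_unique cyls_gen cyls_setI cyls_setT) => _ B [->|[t ->]] mB.
    by rewrite set0X !measure0.
  rewrite [RHS](_ : _ = \int[nu]_(y in B) (p t y)%:E)%E; last first.
    by rewrite pE.
  have mF := measurable_preimage (measurable_sample mp) (measurable_cyl t).
  rewrite /law /pushforward /= (_ : _ @^-1` _ = sample p @^-1` cyl t `&` fst @^-1` B)//.
  rewrite prod_fiber//; apply: ge0_ae_eq_integral => //.
  - exact/measurable_funTS/measurable_fun_fiber.
  - exact/measurable_EFinP/measurable_funTS.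
  - by move=> y _; rewrite lee_fin; have [_ + _ _ _] := hp t; apply.
  - by apply: filterS cp => y cy _; rewrite -(unif_sample mp t cy).
have ms := measurable_sample mp.
exists (r \o sample p); split; first exact: measurableT_comp.
split; first by apply: measurable_fun_pair => //; exact: measurableT_comp.
move=> A mA.
have m3 : measurable_fun setT (fun xy : bits * Y => (r xy.1, xy.2)).
  apply: measurable_fun_pair => //.
  exact: (measurableT_comp mr measurable_fst).
have := key _ (measurable_preimage m3 mA).
rewrite /law /pushforward => h; rewrite [LHS]h; congr (lam _).
by apply/seteqP; split=> -[v y] /=; rewrite er.
Qed.

End sampler.

(** * Law of large numbers and independent noise *)

Section lln.
Local Open Scope ereal_scope.
Context d (T : measurableType d) (R : realType) (P : probability T R).
Variables (E : nat -> set T) (p : R).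
Hypothesis mE : forall n, measurable (E n).
Hypothesis PE : forall n, P (E n) = p%:E.
Hypothesis PEI : forall m n, m != n -> P (E m `&` E n) = (p * p)%:E.

Let X n : T -> R := \1_(E n).

Definition hits N (u : T) : R := (\sum_(n < N) X n u)%R.

Let Pfin : P setT \is a fin_num := fin_num_measure P _ measurableT.

Let X2 n : X n \in Lfun P 2%:E.
Proof.
rewrite inE/=; apply/andP; split; rewrite inE/=; first exact: measurable_indic.
rewrite /finite_norm unlock poweR_lty//.
rewrite (eq_integral (fun x => (X n x)%:E)); last first.
  move=> x _ /=; rewrite /X indicE; case: (_ \in _).
    by rewrite normr1 powR1.
  by rewrite normr0 powR0.
rewrite (_ : \int[P]_x (X n x)%:E = p%:E) ?ltry//.
by rewrite -(PE n) /X integral_indic ?setIT.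
Qed.

Let X1 n : X n \in Lfun P 1.
Proof. exact: Lfun_subset12. Qed.

Let hits2 N : hits N \in Lfun P 2%:E.
Proof.
rewrite /hits (_ : (fun _ => _) = (\sum_(n < N) X n)%R); last first.
  by apply/funext => u; rewrite fct_sumE.
have p12 : (1 : \bar R) <= 2%:E by rewrite lee_fin ler1n.
by apply: rpred_sum => n _; exact: X2.
Qed.

Let hitsS N : hits N.+1 = (hits N \+ X N)%R.
Proof. by apply/funext => u; rewrite /hits big_ord_recr. Qed.

Let EX n : 'E_P[X n] = p%:E.
Proof. by rewrite expectation_indic. Qed.

Let covXX m n : m != n -> covariance P (X m) (X n) = 0.
Proof.
move=> mn; rewrite covarianceE// ?Lfun2_mul_Lfun1// !EX.
rewrite (_ : (X m * X n)%R = \1_(E m `&` E n)); last first.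
  by apply/funext => u; rewrite /X indicI.
by rewrite expectation_indic ?PEI ?EFinM ?subee//; exact: measurableI.
Qed.

Let cov_hits N n : (N <= n)%N -> covariance P (hits N) (X n) = 0.
Proof.
elim: N => [_|N IH Nn].
  rewrite (_ : hits 0 = cst 0%R) ?covariance_cst_l//.
  by apply/funext => u; rewrite /hits big_ord0.
by rewrite hitsS covarianceDl// IH ?(ltnW Nn)// covXX ?adde0// ltn_eqF.
Qed.

Let varX n : 'V_P[X n] <= 1.
Proof.
rewrite varianceE// (_ : X n ^+ 2 = X n)%R; last first.
  by apply/funext => u; rewrite /X !fctE indicE; case: (_ \in _); rewrite ?expr1n ?expr0n.
rewrite EX; have p1 : (p <= 1)%R.
  by rewrite -lee_fin -(PE 0); exact: probability_le1.
by rewrite -EFin_expe -EFinB lee_fin; have := sqr_ge0 p; lra.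
Qed.

Let var_hits N : 'V_P[hits N] <= N%:R%:E.
Proof.
elim: N => [|N IH].
  rewrite (_ : hits 0 = cst 0%R) ?variance_cst//.
  by apply/funext => u; rewrite /hits big_ord0.
rewrite hitsS varianceD// cov_hits// mule0 adde0 -natr1 EFinD.
exact: leeD.
Qed.

Let E_hits N : 'E_P[hits N] = (N%:R * p)%:E.
Proof.
elim: N => [|N IH].
  rewrite (_ : hits 0 = cst 0%R) ?expectation_cst ?mul0r//.
  by apply/funext => u; rewrite /hits big_ord0.
rewrite hitsS expectationD ?Lfun_subset12//.
by rewrite IH EX -EFinD -natr1 mulrDl mul1r.
Qed.

Lemma measurable_hits N : measurable_fun setT (hits N).
Proof.
by apply: measurable_sum => n; exact: measurable_indic.
Qed.

(** Pairwise independence makes the variance of the number of occurrences additive,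
hence at most N, and the bound is Chebyshev's inequality. *)
Lemma hits_deviation N (a : R) : (0 < a)%R ->
  P [set u | (a <= `|hits N u - N%:R * p|)%R] <= (a ^- 2 * N%:R)%:E.
Proof.
move=> a0; have mc := measurable_hits N.
pose C : {RV P >-> R} := HB.pack_for {mfun T >-> R} (hits N)
  (isMeasurableFun.Build _ _ _ _ (hits N) mc).
have := chebyshev C a0; rewrite /= E_hits/= => /le_trans; apply.
by rewrite EFinM; apply: lee_wpmul2l => //; rewrite lee_fin invr_ge0 exprn_ge0// ltW.
Qed.

End lln.

Section iid.
Context (R : realType).
Local Notation noise := (noise R).
Local Notation unif := (unif R).

(** The uniform law of the square is the law of a point of V = [0, 1)^2 joined with
a one-point space, and the sampler over a point is a function of the noise only. *)
Lemma split_noise : exists th : noise -> noise * noise,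
  measure_preserving unif (pprod unif unif) th.
Proof.
have rR : cantor_retract noise.
  exact: (standard_borel_retract (standard_borel_real R)).
have m1 : measurable_fun setT (fun uv : noise * noise => (uv, tt)).
  by apply: measurable_fun_pair => //; exact: measurable_cst.
have m2 : measurable_fun setT (fun _ : noise => tt) by exact: measurable_cst.
pose lam : probability ((noise * noise) * unit)%type R := law (pprod unif unif) m1.
pose nu : probability unit R := law unif m2.
have [||q [mq [mq' hq]]] := @sampler R _ unit _ (noise * noise)%type lam nu.
- exact: cantor_retract_pair.
- split; first exact: measurable_snd.
  move=> A mA; rewrite /lam /nu /law /pushforward /=.
  have [->|->] : A = set0 \/ A = setT.
    have [At|At] := pselect (A tt); [right|left]; apply/seteqP; split=> // -[] //.
    by rewrite !preimage_set0 !measure0.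
  by rewrite !preimage_setT !probability_setT.
exists (fun u => q (tt, u)); split.
  exact: (measurable_fun_pair2 tt mq).
move=> A mA; have mA' : measurable (A `*` [set: unit]) by exact: measurableX.
transitivity (lam (A `*` setT)); last first.
  have e : (fun uv : noise * noise => (uv, tt)) @^-1` (A `*` setT) = A.
    by apply/seteqP; split=> // x [].
  by rewrite -[RHS](congr1 (pprod unif unif) e).
rewrite -hq// /pushforward.
rewrite (_ : _ @^-1` _ = (q @^-1` A) `&` fst @^-1` setT); last first.
  by apply/seteqP; split=> [x []//|x []].
rewrite prod_fiber//.
rewrite (eq_integral (fun _ => unif [set u | A (q (tt, u))])); last by move=> [].
transitivity (unif [set u | A (q (tt, u))] * nu setT)%E.
  by rewrite probability_setT mule1.
exact/esym/integral_cst.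
Qed.

(** One noise gives two independent ones; keep the first and split the second
again, indefinitely. *)
Lemma iid_noise : exists w : nat -> noise -> noise,
  (forall n, measure_preserving unif unif (w n)) /\
  forall N (E : nat -> set noise), (forall n, measurable (E n)) ->
    unif [set u | forall n, (n < N)%N -> E n (w n u)] = (\prod_(n < N) unif (E n))%E.
Proof.
have [th [mth hth]] := split_noise.
have m1 : measurable_fun setT (fst \o th) by exact: measurableT_comp.
have m2 : measurable_fun setT (snd \o th) by exact: measurableT_comp.
(* Every application of th delivers one noise as first component and leaves the
   second one for the following steps. *)
pose w n u := (th (iter n (snd \o th) u)).1.
have mw n : measurable_fun setT (w n).
  elim: n => [//|n IH]; rewrite (_ : w n.+1 = w n \o (snd \o th)).
    exact: measurableT_comp.
  by apply/funext => u; rewrite /w iterSr.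
suff iid N (E : nat -> set noise) : (forall n, measurable (E n)) ->
    unif [set u | forall n, (n < N)%N -> E n (w n u)] = (\prod_(n < N) unif (E n))%E.
  exists w; split => // n; split=> // A mA.
  have := iid n.+1 (fun k => if k == n then A else setT).
  rewrite big_ord_recr /= eqxx big1 ?mul1e; last first.
    by move=> i _; rewrite ltn_eqF//; exact: probability_setT.
  move=> <-; last by move=> k; case: ifP.
  rewrite /pushforward; congr (uniform_prob _ _).
  apply/seteqP; split=> u /=; first by move=> Au k _; case: eqP => // ->.
  by move=> /(_ n (ltnSn n)); rewrite eqxx.
elim: N E => [|N IH] E mE.
  rewrite big_ord0 -(probability_setT unif); congr (uniform_prob _ _).
  by apply/seteqP; split.
pose F := [set u | forall n, (n < N)%N -> E n.+1 (w n u)].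
have mF : measurable F.
  rewrite (_ : F = \bigcap_(n in [set n | (n < N)%N]) (w n @^-1` (E n.+1))).
    by apply: bigcap_measurableType => n _; exact: measurable_preimage.
  by apply/seteqP; split=> u h n; [move=> /h|move=> /(h n)].
rewrite (_ : [set u | _] = th @^-1` (E 0%N `*` F)); last first.
  apply/seteqP; split=> u /=.
    move=> h; split; first exact: (h 0%N).
    by move=> n nN; have := h n.+1 nN; rewrite /w iterSr.
  by move=> [h0 hF] [|n] nN //; rewrite /w iterSr; exact: hF.
rewrite -[LHS]/(pushforward unif th _) hth; last exact: measurableX.
transitivity (unif (E 0%N) * unif F)%E; first by rewrite pprodE.
by rewrite big_ord_recl; congr (_ * _)%E; exact: (IH (fun n => E n.+1)).
Qed.

End iid.

(** * Conditional laws of a sampled joining *)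

Section kernel.
Context (R : realType) dY (Y : measurableType dY) dV (V : measurableType dV).
Variables (q : Y * noise R -> V) (mq : measurable_fun setT q).

(** The conditional probability of A given y under the law sampled by q. It is kept
real-valued so that finite products need no finiteness conditions. *)
Definition kern (A : set V) (y : Y) : R := fine (unif R [set u | A (q (y, u))]).

Lemma kernE A y : measurable A -> (kern A y)%:E = unif R [set u | A (q (y, u))].
Proof.
move=> mA; rewrite /kern fineK// ge0_fin_numE//; apply: (@le_lt_trans _ _ 1%E).
  apply: probability_le1; exact: (measurable_fiber (measurable_preimage mq mA)).
exact: ltry.
Qed.

Lemma kern_itv A y : measurable A -> 0 <= kern A y <= 1.
Proof.
move=> mA; rewrite -!lee_fin kernE// measure_ge0/=; apply: probability_le1.
exact: (measurable_fiber (measurable_preimage mq mA)).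
Qed.

Lemma measurable_kern A : measurable A -> measurable_fun setT (kern A).
Proof.
move=> mA; apply: measurableT_comp => //.
exact: (measurable_fun_fiber _ (measurable_preimage mq mA)).
Qed.

Lemma integral_kern (nu : probability Y R) A B : measurable A -> measurable B ->
  (\int[nu]_(y in B) (kern A y)%:E = pprod nu (unif R) (q @^-1` A `&` fst @^-1` B))%E.
Proof.
move=> mA mB.
rewrite prod_fiber//; by apply: eq_integral => y _; rewrite kernE//.
Qed.

End kernel.

Section invariance.
Context (R : realType) dY (Y : measurableType dY) (nu : probability Y R).
Variables (S : Y -> Y) (bS : bimeasurable S) (hS : measure_preserving nu nu S).

(** Every measurable set is the preimage of one by the automorphism S, so the
hypothesis compares the integrals of f o S and g on all measurable sets. *)
Lemma ae_shift_density (f g : Y -> R) :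
  measurable_fun setT f -> measurable_fun setT g -> (forall y, 0 <= f y <= 1) ->
  (forall y, 0 <= g y <= 1) ->
  (forall B, measurable B -> (\int[nu]_(y in B) (f y)%:E =
     \int[nu]_(y in S @^-1` B) (g y)%:E)%E) ->
  {ae nu, forall y, f (S y) = g y}.
Proof.
move=> mf mg f01 g01 fg; have [mS [S' [SK S'K mS']]] := bS.
apply: ae_eq_density => //.
  by apply: integrable_unit => //; exact: measurableT_comp.
move=> C mC; have CE : C = S @^-1` (S' @^-1` C).
  by apply/seteqP; split=> y /=; rewrite SK.
rewrite {2}CE -fg; last exact: measurable_preimage.
rewrite {1}CE; apply/esym; apply: (integral_preserving hS) => //.
  exact: measurable_preimage.
by move=> y; have /andP[] := f01 y.
Qed.

(** The invariance of lam on the rectangle of A and B says that the integral of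
[kern q A] over B equals that of [kern q (tau @^-1` A)] over the preimage of B. *)
Lemma kern_equivariant dV (V : measurableType dV) (tau : V -> V)
    (lam : probability (V * Y)%type R) (q : Y * noise R -> V) A :
  measurable_fun setT tau -> measurable_fun setT q ->
  measure_preserving (pprod nu (unif R)) lam (fun yu => (q yu, yu.1)) ->
  measure_preserving lam lam (prod_map tau S) -> measurable A ->
  {ae nu, forall y, kern q A (S y) = kern q (tau @^-1` A) y}.
Proof.
move=> mtau mq [mq' hq] [_ hlam] mA; have mS := bS.1.
have mtA : measurable (tau @^-1` A) by exact: measurable_preimage.
apply: (ae_shift_density (f := kern q A) (g := kern q (tau @^-1` A))).
- exact: measurable_kern.
- exact: measurable_kern.
- by move=> y; exact: kern_itv.
- by move=> y; exact: kern_itv.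
move=> B mB; have mSB : measurable (S @^-1` B) by exact: measurable_preimage.
have iA := @integral_kern _ _ _ _ _ q mq nu A B mA mB.
have itA := @integral_kern _ _ _ _ _ q mq nu _ _ mtA mSB.
rewrite iA itA.
have h1 := hq (A `*` B) (measurableX mA mB).
have h2 := hq ((tau @^-1` A) `*` (S @^-1` B)) (measurableX mtA mSB).
have h3 := hlam (A `*` B) (measurableX mA mB).
by transitivity (lam (A `*` B)); [exact: h1|rewrite -h3; exact/esym/h2].
Qed.

End invariance.

(** * Relatively independent gluing of joinings *)

Section joinings.
Context (R : realType) dX (X : measurableType dX) (mu : probability X R) (T : X -> X).
Context dY (Y : measurableType dY) (nu : probability Y R) (S : Y -> Y).
Hypothesis (mT : measurable_fun setT T).
Hypothesis (bS : bimeasurable S) (hS : measure_preserving nu nu S).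

(** A measure of this kind is a joining of S with the joining of copies of T that
it has as first marginal. *)
Definition T_joining (I : countType) (Lam : probability (power I X * Y)%type R) :=
  [/\ forall i, measure_preserving Lam mu (fun w => w.1 i),
      measure_preserving Lam nu snd &
      measure_preserving Lam Lam (prod_map (power_map T) S)].

Lemma measurable_power_map (I : Type) :
  measurable_fun setT (power_map T : power I X -> power I X).
Proof.
apply: measurable_power => i; apply: (measurableT_comp mT).
exact: measurable_power_proj.
Qed.

Section glue.
Variables (I_ : nat -> countType).
Variable Lam_ : forall n, probability (power (I_ n) X * Y)%type R.
Hypothesis hLam : forall n, T_joining (Lam_ n).
Variable q : forall n, Y * noise R -> power (I_ n) X.
Arguments q : clear implicits.
Hypothesis mq : forall n, measurable_fun setT (q n).
Arguments mq : clear implicits.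
Hypothesis hq : forall n, measure_preserving (pprod nu (unif R)) (Lam_ n)
  (fun yu => (q n yu, yu.1)).
Variable w : nat -> noise R -> noise R.
Hypothesis hw : forall n, measure_preserving (unif R) (unif R) (w n).
Hypothesis iid : forall N (E : nat -> set (noise R)), (forall n, measurable (E n)) ->
    unif R [set u | forall n, (n < N)%N -> E n (w n u)] = (\prod_(n < N) unif R (E n))%E.

Local Notation J := {n : nat & I_ n}.

(** Given y, the n-th block of coordinates is sampled with the n-th of a sequence
of independent noises. This is the relatively independent joining over Y of the
joinings [Lam_ n], on the disjoint union of their index sets. *)
Definition glued (yu : Y * noise R) : power J X :=
  fun j => q (tag j) (yu.1, w (tag j) yu.2) (tagged j).

Definition restr n (x : power J X) : power (I_ n) X := fun i => x (Tagged I_ i).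

Arguments restr : clear implicits.

Lemma measurable_restr n : measurable_fun setT (restr n).
Proof. by apply: measurable_power => i; exact: measurable_power_proj. Qed.

Lemma measurable_glued : measurable_fun setT glued.
Proof.
apply: measurable_power => j; rewrite /glued.
have m1 := measurableT_comp (mq (tag j)) (preserving_prod (preserving_id nu) (hw (tag j))).1.
have m2 := @measurable_power_proj (I_ (tag j)) _ X (tagged j).
exact: (measurableT_comp m2 m1).
Qed.

Let mgf : measurable_fun setT (fun yu => (glued yu, yu.1)).
Proof. by apply: measurable_fun_pair => //; exact: measurable_glued. Qed.

Definition glued_law : probability (power J X * Y)%type R :=
  law (pprod nu (unif R)) mgf.

Lemma glued_law_restr n :
  measure_preserving glued_law (Lam_ n) (fun w => (restr n w.1, w.2)).
Proof.
apply: preserving_law.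
  apply: measurable_fun_pair => //.
  exact: (measurableT_comp (@measurable_restr n) (@measurable_fst _ _ (power J X) Y)).
exact: (preserving_comp (preserving_prod (preserving_id nu) (hw n)) (hq n)).
Qed.

Definition box (A : forall n, set (power (I_ n) X)) : set (power J X) :=
  [set x | forall n, A n (restr n x)].

(** Conditions on finitely many blocks of coordinates. They generate the product
sigma-algebra, and on them the conditional glued law is a finite product. *)
Definition boxes : set (set (power J X)) :=
  [set C | exists (A : forall n, set (power (I_ n) X)) (N : nat),
    [/\ forall n, measurable (A n), forall n, (N <= n)%N -> A n = setT & C = box A]].

Lemma boxes_setI : setI_closed boxes.
Proof.
move=> C D [A [N [mA AN ->]]] [B [M [mB BM ->]]].
exists (fun n => A n `&` B n), (maxn N M); split.
- by move=> n; exact: measurableI.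
- by move=> n; rewrite geq_max => /andP[Nn Mn]; rewrite AN// BM// setIT.
- by apply/seteqP; split=> x /=; [move=> [a b] n|move=> h; split=> n; have [] := h n].
Qed.

Lemma boxes_setT : boxes setT.
Proof. by exists (fun _ => setT), 0%N; split => //; apply/seteqP; split. Qed.

Lemma boxes_gen : @measurable _ (power J X) = <<s boxes >>.
Proof.
rewrite eqEsubset; split; last first.
  apply: smallest_sub; first exact: sigma_algebra_measurable.
  move=> _ [A [N [mA _ ->]]].
  rewrite (_ : box A = \bigcap_n (restr n @^-1` A n)); last first.
    by apply/seteqP; split=> x h n => [_|]; exact: h.
  apply: bigcapT_measurable => n; apply: measurable_preimage => //.
  exact: measurable_restr.
apply: smallest_sub; first exact: smallest_sigma_algebra.
move=> _ [j [A [mA ->]]]; apply: sub_sigma_algebra.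
(* For n <> tag j the condition is vacuous, and for n = tag j it bears on the
   coordinate j only; the indirect form avoids a transport along tag j = n. *)
exists (fun n => [set z : power (I_ n) X | forall i, Tagged I_ i = j -> A (z i)]), (tag j).+1.
split.
- move=> n.
  rewrite (_ : [set z | _] =
    ~` \bigcup_i (if `[< Tagged I_ i = j >] then ~` ((fun z : power (I_ n) X => z i) @^-1` A)
                  else set0)); last first.
    apply/seteqP; split=> z /=.
      by move=> h [i _]; case: asboolP => // /h Az; apply.
    by move=> h i ij; apply: contrapT => nA; apply: h; exists i => //; case: asboolP.
  apply: measurableC; apply: countable_bigcupT_measurable => // i.
  case: ifP => // _; apply: measurableC; apply: measurable_preimage => //.
  exact: measurable_power_proj.
- move=> n jn; apply/seteqP; split=> // z _ i ij.
  by move: jn; rewrite -ij ltnn.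
- apply/seteqP; split=> x /=; first by move=> Ax n i ij; rewrite /restr ij.
  by move=> /(_ (tag j) (tagged j)); rewrite /restr /= taggedK; exact.
Qed.

Lemma glued_fiber (A : forall n : nat, set (power (I_ n) X)) N y :
    (forall n, measurable (A n)) -> (forall n, (N <= n)%N -> A n = setT) ->
  unif R [set u | box A (glued (y, u))] = (\prod_(n < N) kern (q n) (A n) y)%:E.
Proof.
move=> mA AN; pose E n := [set u | A n (q n (y, u))].
have mE n : measurable (E n).
  exact: (measurable_fiber (measurable_preimage (mq n) (mA n))).
rewrite (_ : [set u | _] = [set u | forall n, (n < N)%N -> E n (w n u)]); last first.
  apply/seteqP; split=> u h n; first by move=> _; exact: h.
  by have [/AN ->//|/h] := leqP N n.
rewrite iid// -prodEFin; apply: eq_bigr => n _.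
by rewrite kernE.
Qed.

Let mprod (A : forall n : nat, set (power (I_ n) X)) N : (forall n, measurable (A n)) ->
  measurable_fun setT (fun y => \prod_(n < N) kern (q n) (A n) y).
Proof.
by move=> mA; apply: measurable_prod => n _; exact: (measurable_kern (mq n) (mA n)).
Qed.

Let prod_ge0 (A : forall n : nat, set (power (I_ n) X)) N y : (forall n, measurable (A n)) ->
  0 <= \prod_(n < N) kern (q n) (A n) y.
Proof.
by move=> mA; apply: prodr_ge0 => n _; have /andP[] := kern_itv (mq n) y (mA n).
Qed.

Lemma glued_law_box (A : forall n : nat, set (power (I_ n) X)) N B :
    (forall n, measurable (A n)) -> (forall n, (N <= n)%N -> A n = setT) -> measurable B ->
  glued_law (box A `*` B) = (\int[nu]_(y in B) (\prod_(n < N) kern (q n) (A n) y)%:E)%E.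
Proof.
move=> mA AN mB; rewrite lawE.
rewrite (_ : _ @^-1` _ = (glued @^-1` box A) `&` fst @^-1` B)//.
rewrite prod_fiber//; apply: eq_integral => y _.
exact: glued_fiber.
Qed.

(** On a box times B the glued law is the integral over B of the product of the
conditional probabilities of its sides. Each of these is equivariant almost
everywhere, and nu is invariant. *)
Lemma glued_law_joining : T_joining glued_law.
Proof.
split.
- move=> [n i]; have [h _ _] := hLam n.
  exact: (preserving_comp (glued_law_restr n) (h i)).
- by have [_ h _] := hLam 0%N; exact: (preserving_comp (glued_law_restr 0) h).
have mS := bS.1.
have mTS : measurable_fun setT (prod_map (power_map T : power J X -> power J X) S).
  apply: measurable_fun_pair.
    exact: (measurableT_comp (@measurable_power_map J) measurable_fst).
  exact: (measurableT_comp mS measurable_snd).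
apply: (preserving_lawP (mf := mTS)) => E mE.
apply: (prob_prod_unique boxes_gen boxes_setI boxes_setT _ mE).
move=> _ B [A [N [mA AN ->]]] mB.
pose A' n : set (power (I_ n) X) := (power_map T : power (I_ n) X -> power (I_ n) X) @^-1` A n.
have mA' n : measurable (A' n).
  by apply: measurable_preimage => //; exact: measurable_power_map.
have AN' n : (N <= n)%N -> A' n = setT by move=> /AN; rewrite /A' => ->.
rewrite lawE [X in glued_law X](_ : _ = box A' `*` (S @^-1` B)); last by [].
rewrite (glued_law_box mA' AN' (measurable_preimage mS mB)) (glued_law_box mA AN mB).
rewrite (integral_preserving hS mB (@mprod A N mA)); last first.
  by move=> y; exact: prod_ge0.
apply: ge0_ae_eq_integral.
- exact: measurable_preimage.
- apply/measurable_EFinP/measurable_funTS; exact: (@mprod A' N mA').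
- apply/measurable_EFinP/measurable_funTS; exact: (measurableT_comp (@mprod A N mA) mS).
- by move=> y _; rewrite lee_fin; exact: prod_ge0.
- by move=> y _; rewrite lee_fin; exact: prod_ge0.
have : {ae nu, forall y, forall n, kern (q n) (A n) (S y) = kern (q n) (A' n) y}.
  apply: ae_forall_count => n; have [_ _ hn] := hLam n.
  exact: (kern_equivariant bS hS (@measurable_power_map (I_ n)) (mq n) (hq n) hn).
by apply: filterS => y hy _; congr EFin; apply: eq_bigr => n _; rewrite hy.
Qed.

End glue.
End joinings.

(** * Events shared with a self-joining *)

Lemma iid_pair (R : realType) (w : nat -> noise R -> noise R) (G : set (noise R)) m n :
  (forall N (E : nat -> set (noise R)), (forall n, measurable (E n)) ->
    unif R [set u | forall n, (n < N)%N -> E n (w n u)] = (\prod_(n < N) unif R (E n))%E) ->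
  measurable G -> m != n ->
  unif R ((w m @^-1` G) `&` (w n @^-1` G)) = (unif R G * unif R G)%E.
Proof.
move=> iid mG mn; have := iid (maxn m n).+1 (fun k => if (k == m) || (k == n) then G else setT).
have mN : (m < (maxn m n).+1)%N by rewrite ltnS leq_maxl.
have nN : (n < (maxn m n).+1)%N by rewrite ltnS leq_maxr.
rewrite (bigD1 (Ordinal mN))//= (bigD1 (Ordinal nN))/=; last by rewrite -val_eqE/= eq_sym.
rewrite !eqxx orbT/= big1 ?mule1; last first.
  move=> i /andP[]; rewrite -!val_eqE/= => /negbTE -> /negbTE ->.
  exact: probability_setT.
move=> <-; last by move=> k; case: ifP.
congr (uniform_prob _ _); apply/seteqP; split=> u /=.
  by move=> [um un] k _; case: eqP => [->//|_]; case: eqP => [->|].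
move=> h; split; first by have := h m mN; rewrite eqxx.
by have := h n nN; rewrite eqxx orbT.
Qed.

(** Powers of 4 and 8 are expressed through x = 2^k so that inequalities between
them become polynomial inequalities in x. *)
Lemma pow48 (R : realType) k : let x : R := 2 ^+ k in
  [/\ 0 < x, 4 ^+ k = x * x & 8 ^+ k = x * x * x].
Proof.
split; first exact: exprn_gt0.
  by rewrite -exprMn; congr (_ ^+ _); ring.
by rewrite -!exprMn; congr (_ ^+ _); ring.
Qed.

Section events.
Context (R : realType) dX (X : measurableType dX) (mu : probability X R) (T : X -> X).
Context dY (Y : measurableType dY) (nu : probability Y R) (S : Y -> Y).
Hypothesis hT : dynamical_system mu T.
Hypothesis hS : dynamical_system nu S.

(** The events of Y that are visible, modulo null sets, in some system made of
copies of T. The first marginal of Lam plays the part of that system. *)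
Definition T_event (B : set Y) : Prop := measurable B /\
  exists (I : countType) (Lam : probability (power I X * Y)%type R)
    (D : set (power I X)),
  [/\ T_joining mu T nu S Lam, measurable D & {ae Lam, forall w, D w.1 <-> B w.2}].

Let mT : measurable_fun setT T.
Proof. by have [_ []] := hT. Qed.

Let bS : bimeasurable S.
Proof. by have [_] := hS. Qed.

Let pS : measure_preserving nu nu S.
Proof. by have [_ _] := hS. Qed.

Let rX : cantor_retract X.
Proof. by have [/standard_borel_retract] := hT. Qed.

Lemma joining_sampler (I : countType) (Lam : probability (power I X * Y)%type R) :
  T_joining mu T nu S Lam -> exists q : Y * noise R -> power I X,
    measurable_fun setT q /\
    measure_preserving (pprod nu (unif R)) Lam (fun yu => (q yu, yu.1)).
Proof. by case=> _ h _; apply: sampler => //; exact: cantor_retract_power. Qed.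

(** The data behind [T_event] as a structure in Type, so that they can be projected
for each member of a sequence of T-events and assembled into dependent families. *)
Record T_witness (B : set Y) := TWitness {
  witness_index : countType;
  witness_law : probability (power witness_index X * Y)%type R;
  witness_event : set (power witness_index X);
  witness_joining : T_joining mu T nu S witness_law;
  witness_measurable : measurable witness_event;
  witness_ae : {ae witness_law, forall w, witness_event w.1 <-> B w.2} }.

Arguments witness_event {B} _.

Lemma T_eventW B : T_event B -> T_witness B.
Proof.
case=> _ /cid[I /cid[Lam /cid[D [jL mD aD]]]].
exact: (TWitness jL mD aD).
Qed.

(** Each T-event is still visible in the glued joining, because its own joining is
the projection of the glued one to a block of coordinates. *)
Lemma common_joining (B : nat -> set Y) : (forall n, T_event (B n)) ->
  exists (I : countType) (Lam : probability (power I X * Y)%type R)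
    (D : nat -> set (power I X)),
  T_joining mu T nu S Lam /\
  forall n, measurable (D n) /\ {ae Lam, forall w, D n w.1 <-> B n w.2}.
Proof.
move=> hB; have W n := T_eventW (hB n).
have Q n := cid (joining_sampler (witness_joining (W n))).
pose q n := projT1 (Q n); have hq n := projT2 (Q n).
have mq n : measurable_fun setT (q n) := (hq n).1.
have hLam n := witness_joining (W n).
have [w [hw iid]] := iid_noise R.
have jLam := glued_law_joining mT bS pS hLam mq (fun n => (hq n).2) hw iid.
have rLam n := glued_law_restr mq (fun n => (hq n).2) hw n.
exists {n : nat & witness_index (W n)}, (glued_law nu mq hw).
exists (fun n => (fun x => restr x) @^-1` witness_event (W n)); split=> // n.
split.
  by apply: measurable_preimage; [exact: measurable_restr|exact: witness_measurable].
exact: (ae_preserving (rLam n) (witness_ae (W n))).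
Qed.

(** Glue infinitely many copies of lam over Y. Given y, the X-coordinates visit A
independently with probability f y, so by the law of large numbers f y is
determined almost surely by the frequency of these visits. *)
Lemma cond_prob_events (lam : probability (X * Y)%type R) (A : set X) :
  joining mu T nu S lam -> measurable A ->
  exists f : Y -> R,
  [/\ measurable_fun setT f, forall y, 0 <= f y <= 1,
      forall B, measurable B -> (\int[nu]_(y in B) (f y)%:E = lam (A `*` B))%E &
      forall c : R, T_event [set y | f y < c]].
Proof.
move=> [lX lY lTS] mA.
(* lam becomes a joining of S with a family consisting of one copy of T. *)
pose emb (xy : X * Y) : power unit X * Y := (fun _ => xy.1, xy.2).
have memb : measurable_fun setT emb.
  by apply: measurable_fun_pair => //; apply: measurable_power => _; exact: measurable_fst.
pose Lam1 := law lam memb.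
have jLam1 : T_joining mu T nu S Lam1.
  split.
  - move=> i; apply: preserving_law lX.
    exact: (measurableT_comp (@measurable_power_proj unit _ X i)
      (@measurable_fst _ _ (power unit X) Y)).
  - by apply: preserving_law lY; exact: (@measurable_snd _ _ (power unit X) Y).
  - have h := preserving_comp lTS (law_preserving lam memb).
    apply: preserving_law; last exact: h.
    by apply: measurable_prod_map; [exact: measurable_power_map|exact: bS.1].
have [q [mq hq]] := joining_sampler jLam1.
have [w [hw iid]] := iid_noise R.
pose I_ (n : nat) : countType := unit.
pose J : countType := {n : nat & I_ n}.
have mq_ (n : nat) : measurable_fun setT q := mq.
pose Lam : probability (power J X * Y)%type R :=
  @glued_law R _ X _ Y nu I_ (fun _ => q) mq_ w hw.
have jLam : T_joining mu T nu S Lam.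
  exact: (@glued_law_joining R _ X mu T _ Y nu S mT bS pS I_ (fun _ => Lam1)
    (fun _ => jLam1) (fun _ => q) mq_ (fun _ => hq) w hw iid).
pose A1 : set (power unit X) := [set x | A (x tt)].
have mA1 : measurable A1.
  by exact: (measurable_preimage (@measurable_power_proj unit _ X tt) mA).
pose f := kern q A1.
have mf : measurable_fun setT f by exact: measurable_kern.
have f01 y : 0 <= f y <= 1 by exact: kern_itv.
exists f; split => //.
  move=> B mB; rewrite (integral_kern mq nu mA1 mB).
  transitivity (Lam1 (A1 `*` B)); last by [].
  by rewrite -hq.2//; exact: measurableX.
move=> c; pose tag_ n : J := Tagged I_ (tt : I_ n).
pose C n : set (power J X) := [set x | A (x (tag_ n))].
have mC n : measurable (C n).
  exact: (measurable_preimage (@measurable_power_proj J _ X (tag_ n)) mA).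
pose cnt N (x : power J X) : R := @hits _ _ R C N x.
have mcnt N : measurable_fun setT (cnt N) by exact: measurable_hits.
(* By Chebyshev's inequality the number of visits of the first 8^k copies is
   within 4^k of 8^k f(y), except with probability 8^k / 16^k = 2^-k, which is
   summable. As 4^k is negligible before 8^k, f(y) < c holds exactly when the
   inequality of Dk is satisfied for all large k. *)
pose Dk k := [set x | cnt (8 ^ k)%N x + 4 ^+ k < c * 8 ^+ k].
have mDk k : measurable (Dk k).
  apply: measurable_bool_set; apply: measurable_fun_ltr => //.
  exact: measurable_funD.
pose D := \bigcup_K \bigcap_(k in [set k | (K <= k)%N]) Dk k.
have mD : measurable D.
  apply: bigcupT_measurable => K; apply: bigcap_measurableType => k _; exact: mDk.
have mfc : measurable [set y | f y < c].
  by apply: measurable_bool_set; exact: measurable_fun_ltr.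
split => //; exists J, Lam, D; split => //.
apply: ae_law.
  have m1 := measurable_preimage (@measurable_fst _ _ (power J X) Y) mD.
  have m2 := measurable_preimage (@measurable_snd _ _ (power J X) Y) mfc.
  exact: (measurable_iff m1 m2).
pose g (yu : Y * noise R) : power J X := @glued _ _ X _ Y I_ (fun _ => q) w yu.
have mg : measurable_fun setT g by exact: measurable_glued.
pose F k : set (Y * noise R) :=
  [set yu | 4 ^+ k <= `|cnt (8 ^ k)%N (g yu) - (8 ^ k)%:R * f yu.1| ].
have mF k : measurable (F k).
  apply: measurable_bool_set; apply: measurable_fun_ler => //.
  apply: measurableT_comp => //; apply: measurable_funB.
    exact: (measurableT_comp (mcnt (8 ^ k)%N) mg).
  apply: measurable_funM => //.
  exact: (measurableT_comp mf measurable_fst).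
have fiberF k y : (unif R [set u | F k (y, u)] <= (2 ^- k)%:E)%E.
  pose G := [set u | A1 (q (y, u))].
  have mG : measurable G by exact: (measurable_fiber (measurable_preimage mq mA1)).
  pose E n := w n @^-1` G.
  have mE n : measurable (E n) by exact: measurable_preimage (hw n).1 mG.
  have PG : unif R G = (f y)%:E by rewrite /f kernE.
  have PE n : unif R (E n) = (f y)%:E by rewrite -PG; exact: (hw n).2.
  have PEI m n : m != n -> unif R (E m `&` E n) = (f y * f y)%:E.
    by move=> mn; rewrite /E iid_pair// PG.
  have [x0 x4 x8] := pow48 R k.
  have a0 : 0 < (4 : R) ^+ k by exact: exprn_gt0.
  have := hits_deviation mE PE PEI (8 ^ k)%N a0.
  rewrite (_ : (4 ^+ k) ^- 2 * (8 ^ k)%:R = 2 ^- k :> R); last first.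
    by rewrite natrX x4 x8; field; rewrite gt_eqF.
  apply: le_trans; apply: le_measure; rewrite ?inE.
  - exact: (measurable_fiber (mF k)).
  - apply: measurable_bool_set; apply: measurable_fun_ler => //.
    apply: measurableT_comp => //; apply: measurable_funB => //.
    exact: measurable_hits.
  - have e u : hits R E (8 ^ k)%N u = cnt (8 ^ k)%N (g (y, u)).
      rewrite /cnt /hits; apply: eq_bigr => n _; rewrite !indicE.
      by congr (_%:R); congr nat_of_bool; apply/idP/idP; rewrite !inE.
    by move=> u h /=; rewrite e; exact: h.
have PF k : (pprod nu (unif R) (F k) <= (2 ^- k)%:E)%E.
  rewrite -[F k]setIT -(preimage_setT fst) prod_fiber//.
  apply: (@le_trans _ _ (\int[nu]_y (2 ^- k)%:E)%E).
    apply: ge0_le_integral => //.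
    - exact: measurable_fun_fiber.
  by rewrite integral_cst//= probability_setT mule1.
have := eventually_notin mF PF; apply: filterS => -[y u] [K hK] /=.
have dev k : (K <= k)%N -> `|cnt (8 ^ k)%N (g (y, u)) - 8 ^+ k * f y| < 4 ^+ k.
  by move=> /hK /negP; rewrite -ltNge natrX.
split=> [[K' _ hD]|fc].
  have := hD (maxn K K') (leq_maxr _ _); rewrite /Dk/=.
  have := dev (maxn K K') (leq_maxl _ _); rewrite ltr_norml => /andP[h _].
  move: h; set v := cnt _ _; set a := 4 ^+ _; set b := 8 ^+ _ => h1 h2.
  have b0 : 0 < b by exact: exprn_gt0.
  by rewrite -(ltr_pM2r b0); lra.
have cf0 : 0 < (c - f y) / 2 by lra.
pose K' := Num.truncn ((c - f y) / 2)^-1.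
exists (maxn K K') => // k /=; rewrite geq_max => /andP[Kk K'k].
rewrite /Dk/=; have := dev k Kk; rewrite ltr_norml => /andP[_].
have [] := pow48 R k; set x := 2 ^+ k => x0 -> -> h.
have xc : ((c - f y) / 2)^-1 < x.
  have /lt_le_trans := truncnS_gt ((c - f y) / 2)^-1; apply.
  rewrite /x -natrX ler_nat; apply: leq_trans (ltn_expl K' (ltnSn 1)) _.
  by rewrite leq_exp2l.
have h2 : 1 < x * ((c - f y) / 2) by rewrite -ltr_pdivrMr// div1r.
have h3 : x * x < x * x * (x * ((c - f y) / 2)).
  by rewrite ltr_pMr// mulr_gt0.
move: h; rewrite -/(g (y, u)); set v := cnt _ _ => h; nra.
Qed.

End events.

(** * Events of a T-factor are shared *)

Section factor_event.
Context (R : realType) dX (X : measurableType dX) (mu : probability X R) (T : X -> X).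
Context dY (Y : measurableType dY) (nu : probability Y R) (S : Y -> Y).
Hypothesis hT : dynamical_system mu T.
Hypothesis hS : dynamical_system nu S.
Context dZ (Z : measurableType dZ) (rho : probability Z R) (U : Z -> Z).
Hypothesis hU : dynamical_system rho U.
Variable pi : Y -> Z.
Hypothesis hpi : homomorphism nu S rho U pi.
Variables (I : countType) (lambda : probability (power I X) R).
Hypothesis hl : self_joining mu T lambda.
Variable phi : power I X -> Z.
Hypothesis hphi : homomorphism lambda (power_map T) rho U phi.

Let mT : measurable_fun setT T.
Proof. by have [_ []] := hT. Qed.

Let mpT : measurable_fun setT (power_map T : power I X -> power I X).
Proof. exact: measurable_power_map. Qed.

Let bS : bimeasurable S.
Proof. by have [_] := hS. Qed.

Let pS : measure_preserving nu nu S.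
Proof. by have [_ _] := hS. Qed.

Let bU : bimeasurable U.
Proof. by have [_] := hU. Qed.

Let pU : measure_preserving rho rho U.
Proof. by have [_ _] := hU. Qed.

Let rX : cantor_retract (power I X).
Proof. by apply: cantor_retract_power; have [/standard_borel_retract] := hT. Qed.

Let mphi : measurable_fun setT phi := hphi.1.1.

Let mgraph : measurable_fun setT (fun x : power I X => (x, phi x)).
Proof. exact: measurable_fun_pair. Qed.

(** Sampling this law over rho yields the conditional law of the self-joining given
its factor Z. Sampled at pi y instead, with y of law nu, it gives the relatively
independent joining over Z. *)
Let graph : probability (power I X * Z)%type R := law lambda mgraph.

Let graph_snd : measure_preserving graph rho snd.
Proof. by apply: preserving_law hphi.1; exact: measurable_snd. Qed.

Let graph_inv : measure_preserving graph graph (prod_map (power_map T) U).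
Proof.
have mm : measurable_fun setT (prod_map (power_map T : power I X -> power I X) U).
  exact: (measurable_prod_map mpT bU.1).
apply: preserving_law => //; split=> [|A mA].
  exact: (measurableT_comp mm mgraph).
transitivity (lambda ((power_map T) @^-1` [set x | A (x, phi x)])); last first.
  have mA' : measurable [set x : power I X | A (x, phi x)].
    exact: (measurable_preimage mgraph mA).
  exact: (hl.2.2 _ mA').
apply: ae_measure_eq.
- exact: (measurable_preimage (measurableT_comp mm mgraph) mA).
- exact: (measurable_preimage (measurableT_comp mgraph mpT) mA).
by apply: filterS hphi.2 => x e; rewrite /preimage /= /prod_map/= -e.
Qed.

(** In the relatively independent joining of lambda and S over Z the point phi x
equals pi y almost surely. *)
Lemma factor_T_event C : measurable C -> T_event mu T nu S (pi @^-1` C).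
Proof.
move=> mC; have [q [mq hq]] := sampler rX graph_snd.
have [[mpi hpi1] hpi2] := hpi.
have mpp : measurable_fun setT (fun yu : Y * noise R => (pi yu.1, yu.2)).
  exact: (measurable_prod_map mpi (@measurable_id _ _ setT)).
have ppp : measure_preserving (pprod nu (unif R)) (pprod rho (unif R))
    (fun yu => (pi yu.1, yu.2)).
  exact: (preserving_prod hpi.1 (preserving_id (unif R))).
have mJ : measurable_fun setT (fun yu : Y * noise R => (q (pi yu.1, yu.2), yu.1)).
  apply: measurable_fun_pair; last exact: measurable_fst.
  exact: (measurableT_comp mq mpp).
pose Lam : probability (power I X * Y)%type R := law (pprod nu (unif R)) mJ.
have Lg : measure_preserving Lam graph (fun w => (w.1, pi w.2)).
  apply: preserving_law; last exact: (preserving_comp ppp hq).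
  exact: (measurable_prod_map (@measurable_id _ _ setT) mpi).
have gl : measure_preserving graph lambda fst.
  by apply: preserving_law; [exact: measurable_fst|exact: preserving_id].
have LB A B : measurable A -> measurable B ->
    Lam (A `*` B) = (\int[nu]_(y in B) (kern q A (pi y))%:E)%E.
  move=> mA mB; rewrite lawE.
  rewrite [X in pprod nu _ X](_ : _ =
    ((fun yu => q (pi yu.1, yu.2)) @^-1` A) `&` fst @^-1` B)//.
  rewrite prod_fiber//; apply: eq_integral => y _.
  by rewrite kernE.
split; first exact: measurable_preimage.
exists I, Lam, (phi @^-1` C); split.
- split.
  + by move=> i; apply: (preserving_comp (preserving_comp Lg gl) (hl.1 i)).
  + by apply: preserving_law; [exact: measurable_snd|exact: preserving_fst].
  have mTS : measurable_fun setT (prod_map (power_map T : power I X -> power I X) S).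
    exact: (measurable_prod_map mpT bS.1).
  apply: (preserving_lawP (mf := mTS)) => E mE.
  apply: (prob_rect_unique _ mE).
  move=> A B mA mB; rewrite lawE.
  rewrite [X in Lam X](_ : _ = ((power_map T) @^-1` A) `*` (S @^-1` B)); last by [].
  have mA' : measurable ((power_map T : power I X -> power I X) @^-1` A).
    exact: measurable_preimage.
  have mB' : measurable (S @^-1` B) by exact: measurable_preimage bS.1 mB.
  rewrite (LB _ _ mA' mB') (LB _ _ mA mB).
  have mk := measurable_kern mq mA; have mk' := measurable_kern mq mA'.
  have mkpi : measurable_fun setT (fun y => kern q A (pi y)) by exact: measurableT_comp.
  rewrite (@integral_preserving R _ _ _ _ nu nu S (fun y => kern q A (pi y)) B
    pS mB mkpi); last first.
    by move=> y; have /andP[] := kern_itv mq (pi y) mA.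
  apply: ge0_ae_eq_integral => //.
  - apply/measurable_EFinP/measurable_funTS; exact: measurableT_comp mk' mpi.
  - apply/measurable_EFinP/measurable_funTS; exact: (measurableT_comp mkpi bS.1).
  - by move=> y _; rewrite lee_fin; have /andP[] := kern_itv mq (pi y) mA'.
  - by move=> y _; rewrite lee_fin; have /andP[] := kern_itv mq (pi (S y)) mA.
  have := ae_preserving hpi.1 (kern_equivariant bU pU mpT mq hq graph_inv mA).
  by apply: filterS2 hpi2 => y -> e _; rewrite e.
- exact: measurable_preimage.
apply: (ae_preserving (H := fun w => C (phi w.1) <-> C w.2) Lg).
apply: ae_law; last exact: aeW.
apply: (measurable_iff (A := (phi \o fst) @^-1` C) (B := snd @^-1` C)).
- by apply: measurable_preimage => //; exact: (measurableT_comp mphi measurable_fst).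
- exact: measurable_preimage measurable_snd mC.
Qed.

End factor_event.

(** * Shared events generate a T-factor *)

(** R occurs in no coordinate: it is the field of values of the metric put on the
cube, and the structures below could not be inferred from the type if it did not
occur in it. *)
Definition cube (R : realType) (K : countType) : Type := K -> bool.

Section cube.
Variables (R : realType) (K : countType).
Local Notation cube := (cube R K).

HB.instance Definition _ := Pointed.copy cube (K -> bool).

(** Coordinate k has weight 2^-(pickle k), and points at distance less than e agree on all
coordinates of weight at least e. *)
Definition cube_ball (x : cube) (e : R) (y : cube) : Prop :=
  0 < e /\ forall k, e <= 2 ^- pickle k -> x k = y k.

Definition cube_ent : set_system (cube * cube) := entourage_ cube_ball.

HB.instance Definition _ := hasNbhs.Build cube (nbhs_ cube_ent).

Let cube_ball_center (x : cube) (e : R) : 0 < e -> cube_ball x e x.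
Proof. by split. Qed.

Let cube_ball_sym (x y : cube) (e : R) : cube_ball x e y -> cube_ball y e x.
Proof. by move=> [e0 h]; split => // k /h. Qed.

Let cube_ball_triangle (x y z : cube) (e1 e2 : R) :
  cube_ball x e1 y -> cube_ball y e2 z -> cube_ball x (e1 + e2) z.
Proof.
move=> [e10 h1] [e20 h2]; split; first exact: addr_gt0.
move=> k le; rewrite h1 ?h2//; apply: le_trans le; rewrite ?lerDl ?lerDr ltW//.
Qed.

HB.instance Definition _ := Nbhs_isPseudoMetric.Build R cube
  (erefl : nbhs = nbhs_ cube_ent)
  cube_ball_center cube_ball_sym cube_ball_triangle erefl.

Let cube_complete (F : set_system cube) : ProperFilter F -> cauchy F -> cvg F.
Proof.
move=> FF cF; pose l : cube := fun k => `[< F [set x : cube | x k] >].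
apply/cvg_ex; exists l; apply/fcvg_ballP => e e0.
have [x0 Fx0] := (@cauchyP R cube F FF).1 cF e e0.
apply: filterS (Fx0) => y [_ x0y]; split => // k ek; rewrite -x0y// /l.
case x0k: (x0 k).
  by apply/asboolP; apply: filterS Fx0 => z [_ x0z]; rewrite /= -x0z.
apply/asboolP => Fk; have [z [/= zk [_ x0z]]] := filter_ex (filterI Fk Fx0).
by move: zk; rewrite -x0z// x0k.
Qed.

HB.instance Definition _ := Uniform_isComplete.Build cube cube_complete.

Lemma cube_hausdorff : hausdorff_space cube.
Proof.
move=> x y; move=> cl; apply/funext => k.
have [z [[_ xz] [_ yz]]] := cl _ _ (nbhsx_ballx x _ (half_pow_gt0 R (pickle k)))
  (nbhsx_ballx y _ (half_pow_gt0 R (pickle k))).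
by rewrite xz// yz.
Qed.

Definition cube_word (s : seq bool) : cube := fun k => nth false s (pickle k).

Definition cube_pref (x : cube) n : seq bool :=
  mkseq (fun i => if unpickle i is Some k then x k else false) n.

Lemma cube_prefE x n k : (pickle k < n)%N -> cube_word (cube_pref x n) k = x k.
Proof. by move=> kn; rewrite /cube_word nth_mkseq// pickleK. Qed.

Lemma cube_dense : dense (range cube_word).
Proof.
move=> O [x Ox] oO; have /nbhs_ballP[e e0 eO] := open_nbhs_nbhs (conj oO Ox).
have [n ne] := half_pow_small e0.
exists (cube_word (cube_pref x n)); split; last by exists (cube_pref x n).
apply: eO; split => // k ek; rewrite cube_prefE// ltnNge; apply/negP => nk.
have : (2 ^- pickle k : R) <= 2 ^- n.
  by rewrite lef_pV2 ?posrE ?exprn_gt0// ler_eXn2l// ltr1n.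
by move=> /(le_trans ek); rewrite leNgt ne.
Qed.

Definition cube_cyl (s : seq bool) : set cube :=
  [set z | forall k, (pickle k < size s)%N -> z k = cube_word s k].

(** Open sets are countable unions of cylinders, since there are only countably
many finite words. Hence measurability into the cube can be checked on
coordinates. *)
Lemma cube_openE (O : set cube) : open O ->
  O = \bigcup_s (if `[< cube_cyl s `<=` O >] then cube_cyl s else set0).
Proof.
move=> oO; apply/seteqP; split=> x; last by case=> s _; case: asboolP => // sO /sO.
move=> Ox; have /nbhs_ballP[e e0 eO] := open_nbhs_nbhs (conj oO Ox).
have [n ne] := half_pow_small e0; exists (cube_pref x n) => //; case: asboolP => [_|[]].
  by move=> k; rewrite size_mkseq => kn; rewrite cube_prefE.
move=> z hz; apply: eO; split=> // k ek.
have kn : (pickle k < n)%N.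
  rewrite ltnNge; apply/negP => nk; have : (2 ^- pickle k : R) <= 2 ^- n.
    by rewrite lef_pV2 ?posrE ?exprn_gt0// ler_eXn2l// ltr1n.
  by move=> /(le_trans ek); rewrite leNgt ne.
by rewrite hz ?size_mkseq// cube_prefE.
Qed.

Local Notation mcube := (g_sigma_algebraType (@open cube)).

Lemma measurable_cube d (W : measurableType d) (f : W -> mcube) :
  (forall k, measurable [set w | f w k]) -> measurable_fun setT f.
Proof.
move=> mf; apply: (@measurability _ _ W mcube setT f (@open cube)) => //.
move=> _ [V opV <-]; rewrite setTI (cube_openE opV) preimage_bigcup.
apply: countable_bigcupT_measurable => // s; case: ifP => _; last by rewrite preimage_set0.
rewrite (_ : f @^-1` _ = ~` \bigcup_k (if (pickle k < size s)%N then
    (if cube_word s k then ~` [set w | f w k] else [set w | f w k]) else set0)).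
  apply: measurableC; apply: countable_bigcupT_measurable => // k.
  by case: ifP => // _; case: ifP => _; [exact: measurableC|].
apply/seteqP; split=> w /=.
  move=> h [k _]; case: ifP => // ks; rewrite -h//.
  by case: ifPn => [fk|/negP fk]; [apply|].
move=> h k ks; apply: contrapT => ne; apply: h; exists k => //; rewrite ks.
by move: ne; case: (cube_word s k) => /=; case: (f w k).
Qed.

Lemma measurable_cube_coord k : measurable [set z : mcube | z k].
Proof.
apply: sub_sigma_algebra; rewrite openE => z zk.
apply/nbhs_ballP; exists (2 ^- pickle k); first exact: half_pow_gt0.
by move=> y [_ zy]; rewrite /= -zy.
Qed.

Lemma standard_borel_cube : standard_borel R mcube.
Proof.
exists cube; split; first exact: cube_hausdorff.
  exists (range cube_word); last exact: cube_dense.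
  by apply: sub_countable (countableP [set: seq bool]); exact: card_image_le.
by exists id; split; [exact: measurable_id|exists id; split => //; exact: measurable_id].
Qed.

End cube.

Section iterz.
Context (A : Type) (f g : A -> A).

(** Iterates indexed by all integers, with g in the role of the inverse of f. Past
and future visits are both needed for the shift to be invertible. *)
Definition iterz (k : int) : A -> A :=
  match k with Posz n => iter n f | Negz n => iter n.+1 g end.

Lemma iterzS k a : cancel f g -> iterz (k + 1) a = iterz k (f a).
Proof.
move=> fg; case: k => [n|[|n]] /=.
- by rewrite addn1 iterSr.
- by rewrite fg.
- by rewrite subn1 /= -[in RHS]iterS iterSr fg.
Qed.

End iterz.

Lemma preserving_iterz (R : realType) d (W : measurableType d)
    (P : probability W R) (f g : W -> W) k :
  measure_preserving P P f -> measure_preserving P P g ->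
  measure_preserving P P (iterz f g k).
Proof.
move=> hf hg; have it h n : measure_preserving P P h -> measure_preserving P P (iter n h).
  move=> hh; elim: n => [|n IH]; first exact: preserving_id.
  exact: (preserving_comp IH hh).
by case: k => n; [exact: it|exact: (it g n.+1)].
Qed.

Section factor_of_events.
Context (R : realType) dX (X : measurableType dX) (mu : probability X R) (T : X -> X).
Context dY (Y : measurableType dY) (nu : probability Y R) (S : Y -> Y).
Hypothesis hT : dynamical_system mu T.
Hypothesis hS : dynamical_system nu S.

Local Notation Z := (g_sigma_algebraType (@open (cube R (int * nat)%type))).

Definition shift (z : Z) : Z := fun kn => z (kn.1 + 1, kn.2).
Definition unshift (z : Z) : Z := fun kn => z (kn.1 - 1, kn.2).

Lemma shift_bimeasurable : bimeasurable shift.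
Proof.
split.
  by apply: measurable_cube => k; exact: measurable_cube_coord.
exists unshift; split.
- by move=> z; apply/funext => -[k n]; rewrite /shift /unshift/= subrK.
- by move=> z; apply/funext => -[k n]; rewrite /shift /unshift/= addrK.
- by apply: measurable_cube => k; exact: measurable_cube_coord.
Qed.

Definition itinerary d (W : measurableType d) (f g : W -> W) (D : nat -> set W)
    (w : W) : Z := fun kn => `[< D kn.2 (iterz f g kn.1 w) >].

Lemma itinerary_shift d (W : measurableType d) (f g : W -> W) (D : nat -> set W) w :
  cancel f g -> itinerary f g D (f w) = shift (itinerary f g D w).
Proof.
by move=> fg; apply/funext => -[k n]; rewrite /itinerary /shift/= iterzS.
Qed.

Lemma measurable_itinerary d (W : measurableType d) (f g : W -> W) (D : nat -> set W) :
  (forall k, measurable_fun setT (iterz f g k)) -> (forall n, measurable (D n)) ->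
  measurable_fun setT (itinerary f g D).
Proof.
move=> mfg mD; apply: measurable_cube => -[k n].
rewrite (_ : [set w | _] = iterz f g k @^-1` D n).
  exact: measurable_preimage (mfg k) (mD n).
by apply/seteqP; split=> w /=; [move=> /asboolP|move=> h; apply/asboolP].
Qed.

(** In a common joining the two itineraries, of the point of Y through the B n and
of the copies of T through the D n, agree almost surely because B n and D n do
so at almost every point and the joining is invariant. Their common law on the
shift is therefore a factor on both sides, and B n is read at time 0. *)
Lemma factor_of_events (B : nat -> set Y) : (forall n, T_event mu T nu S (B n)) ->
  exists F : set (set Y), T_factor_algebra mu T nu S F /\ forall n, F (B n).
Proof.
move=> hB; have [I [Lam [D [jLam hD]]]] := common_joining hT hS hB.
have [_ [mT [T' [TT' T'T mT']]] pT] := hT.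
have [_ [mS [S' [SS' S'S mS']]] pS] := hS.
have [LX LY LTS] := jLam.
pose tau : power I X -> power I X := power_map T.
pose tau' : power I X -> power I X := power_map T'.
have tt' : cancel tau tau' by move=> x; apply/funext => i; rewrite /tau /tau' /power_map TT'.
have t't : cancel tau' tau by move=> x; apply/funext => i; rewrite /tau /tau' /power_map T'T.
have mtau : measurable_fun setT tau by exact: measurable_power_map.
have mtau' : measurable_fun setT tau' by exact: measurable_power_map.
have pS' : measure_preserving nu nu S' by exact: (preserving_inverse S'S SS').
have mB n : measurable (B n) by have [] := hB n.
have mD n : measurable (D n) by have [] := hD n.
pose lambda : probability (power I X) R := law Lam (@measurable_fst _ _ (power I X) Y).
have pL : measure_preserving Lam lambda fst by exact: law_preserving.
have pl : measure_preserving lambda lambda tau.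
  by apply: preserving_law => //; exact: (preserving_comp LTS pL).
have pl' : measure_preserving lambda lambda tau' by exact: (preserving_inverse t't tt').
pose pi := itinerary S S' B; pose phi := itinerary tau tau' D.
have mpi : measurable_fun setT pi.
  by apply: measurable_itinerary => // k; have [] := preserving_iterz k pS pS'.
have mphi : measurable_fun setT phi.
  by apply: measurable_itinerary => // k; have [] := preserving_iterz k pl pl'.
pose rho : probability Z R := law nu mpi.
have hpi : homomorphism nu S rho shift pi.
  by split; [exact: law_preserving|apply: aeW => y; exact: itinerary_shift].
have mTS : measurable_fun setT (prod_map tau' S') by exact: (measurable_prod_map mtau' mS').
have LTS' : measure_preserving Lam Lam (prod_map tau' S').
  apply: (preserving_inverse _ _ mTS LTS) => -[x y]; rewrite /prod_map/=.
    by rewrite S'S -[X in (X, _)]/(tau (tau' x)) t't.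
  by rewrite SS' -[X in (X, _)]/(tau' (tau x)) tt'.
have itE k x y : iterz (prod_map tau S) (prod_map tau' S') k (x, y) =
    (iterz tau tau' k x, iterz S S' k y).
  have it (a : power I X -> power I X) (b : Y -> Y) n :
      iter n (prod_map a b) (x, y) = (iter n a x, iter n b y).
    by elim: n => //= n ->.
  by case: k => n; [exact: it|exact: (it tau' S' n.+1)].
have same : {ae Lam, forall w, phi w.1 = pi w.2}.
  have : {ae Lam, forall w, forall kn : int * nat,
      D kn.2 (iterz tau tau' kn.1 w.1) <-> B kn.2 (iterz S S' kn.1 w.2)}.
    apply: ae_forall_count => -[k n] /=.
    have := ae_preserving (preserving_iterz k LTS LTS') (hD n).2.
    by apply: filterS => -[x y]; rewrite itE.
  apply: filterS => -[x y] h; apply/funext => kn; rewrite /phi /pi /itinerary/=.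
  by apply/asboolP/asboolP => ?; exact/h.
have hphi : homomorphism lambda tau rho shift phi.
  split; last by apply: aeW => x; exact: itinerary_shift.
  split; first exact: mphi.
  move=> A mA; transitivity (Lam ((phi \o fst) @^-1` A)); first by [].
  transitivity (Lam ((pi \o snd) @^-1` A)); last exact: (LY.2 _ (measurable_preimage mpi mA)).
  apply: ae_measure_eq.
  - exact: (measurable_preimage (measurableT_comp mphi (@measurable_fst _ _ (power I X) Y)) mA).
  - exact: (measurable_preimage (measurableT_comp mpi (@measurable_snd _ _ (power I X) Y)) mA).
  - by apply: filterS same => w; rewrite /preimage/= => ->.
exists (g_sigma_algebra_preimage pi); split; last first.
  move=> n; exists [set z : Z | z (0, n)]; first exact: measurable_cube_coord.
  rewrite setTI; apply/seteqP; split=> y /=; first by move=> /asboolP.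
  by move=> By; apply/asboolP.
exists _, Z, rho, shift, pi; split => //; split.
- split; [exact: standard_borel_cube|exact: shift_bimeasurable|].
  have hh : measure_preserving nu rho (shift \o pi).
    have := preserving_comp pS hpi.1.
    rewrite (_ : pi \o S = shift \o pi)//.
    by apply/funext => y; exact: itinerary_shift.
  by apply: preserving_law hh; exact: shift_bimeasurable.1.
- by exists pi.
- exists I, lambda; split; last by exists phi.
  split=> // i; apply: preserving_law (LX i).
  exact: measurable_power_proj.
Qed.

End factor_of_events.

(** * Separability of the measure algebra *)

Section separability.
Context (R : realType).

Definition prefix_determined m (G : set bits) : Prop :=
  forall x y : bits, pref x m = pref y m -> G x -> G y.

Definition approximable (P : probability bits R) (C : set bits) : Prop :=
  measurable C /\ forall e : R, 0 < e ->
    exists m G, [/\ prefix_determined m G, measurable G & (P (C `+` G) < e%:E)%E].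

(** The class of approximable sets contains the cylinders and is closed under
proper differences and increasing unions, so the pi-lambda theorem applies. *)
Lemma approximable_measurable (P : probability bits R) (C : set bits) :
  measurable C -> approximable P C.
Proof.
move=> mC; rewrite cyls_gen in mC.
suff : <<s cyls >> `<=` approximable P by exact.
apply: (lambda_system_subset cyls_setI) => //; last first.
  move=> _ [->|[t ->]].
    split => // e e0; exists 0%N, set0; split=> //.
    by rewrite setYK measure0 lte_fin.
  split; first exact: measurable_cyl.
  move=> e e0; exists (size t), (cyl t); split; [|exact: measurable_cyl|].
    by move=> x y; rewrite /cyl/= => ->.
  by rewrite setYK measure0 lte_fin.
split => //.
- split => // e e0; exists 0%N, setT; split => //.
  by rewrite setYK measure0 lte_fin.
- move=> A B BA [mA hA] [mB hB]; split; first exact: measurableD.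
  move=> e e0; have e2 : 0 < e / 2 by rewrite divr_gt0.
  have [m [G [fG mG hG]]] := hA _ e2; have [n [H [fH mH hH]]] := hB _ e2.
  exists (maxn m n), (G `\` H); split; [|exact: measurableD|].
    move=> x y xy [Gx nHx]; split.
      by apply: fG Gx; exact: (pref_agree (leq_maxl m n) xy).
    by move=> Hy; apply: nHx; apply: fH Hy; exact/esym/(pref_agree (leq_maxr m n) xy).
  apply: (@le_lt_trans _ _ (P (A `+` G) + P (B `+` H))%E).
    apply: prob_leU; try (apply: measurable_setY => //; exact: measurableD).
    move=> x; rewrite !setY_def /=; have [] := pselect (A x); have [] := pselect (B x);
      have [] := pselect (G x); have [] := pselect (H x); tauto.
  by rewrite [e in ltRHS]splitr EFinD; exact: lteD.
- move=> F ndF hF; have mF n : measurable (F n) by have [] := hF n.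
  have mU : measurable (\bigcup_n F n) by exact: bigcupT_measurable.
  split => // e e0; have e2 : 0 < e / 2 by rewrite divr_gt0.
  have [n hn] : exists n, (P (\bigcup_n F n `\` F n) < (e / 2)%:E)%E.
    pose H n := \bigcup_n F n `\` F n.
    have H0 : \bigcap_n H n = set0.
      by apply/seteqP; split=> // x /[dup] /(_ 0%N I) [[n _ Fx] _] /(_ n I) [].
    have mH n : measurable (H n) by exact: measurableD.
    have niH : nonincreasing_seq H.
      by move=> a b ab; apply/subsetPset; apply: setDS; exact/subsetPset/ndF.
    have := nonincreasing_cvg_mu (le_lt_trans (probability_le1 P (mH 0%N)) (ltry 1)) mH.
    rewrite H0 measure0 => /(_ measurable0 niH) /fine_cvgP[_].
    move=> /cvgrPdist_lt/(_ _ e2)[n _ /(_ n (leqnn n))] /=.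
    rewrite sub0r normrN ger0_norm ?fine_ge0// => h; exists n.
    rewrite -(fineK (_ : P (H n) \is a fin_num)) ?lte_fin//.
    exact: fin_num_measure.
  have [_ /(_ _ e2)[m [G [fG mG hG]]]] := hF n; exists m, G; split => //.
  apply: (@le_lt_trans _ _ (P (\bigcup_n F n `\` F n) + P (F n `+` G))%E).
    apply: prob_leU; try (apply: measurable_setY => //); try exact: measurableD.
    move=> x; rewrite !setY_def /= => -[[Ux nG]|[Gx nU]].
      by have [Fx|nF] := pselect (F n x); [right; left|left].
    by right; right; split => // Fx; apply: nU; exists n.
  by rewrite [e in ltRHS]splitr EFinD; exact: lteD.
Qed.

Fixpoint words m : seq (seq bool) :=
  if m is m'.+1 then [seq true :: t | t <- words m'] ++ [seq false :: t | t <- words m']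
  else [:: [::]].

Lemma pref_words x m : pref x m \in words m.
Proof.
elim: m => [|m IH] //=; rewrite mem_cat; case: (x m).
  by rewrite map_f.
by rewrite orbC map_f.
Qed.

(** Countably many indices suffice to describe all sets determined by a prefix. *)
Definition coded (i : nat * seq (seq bool)) : set bits := [set x | pref x i.1 \in i.2].

Lemma prefix_determined_coded m G : prefix_determined m G -> exists i, G = coded i.
Proof.
move=> fG; exists (m, [seq t <- words m | `[< exists2 x, pref x m = t & G x >]]).
apply/seteqP; split=> x; rewrite /coded/= mem_filter pref_words andbT.
  by move=> Gx; apply/asboolP; exists x.
by move=> /asboolP[y yx Gy]; exact: fG yx Gy.
Qed.

Lemma measurable_coded i : measurable (coded i).
Proof.
rewrite (_ : coded i = \bigcup_(t in [set: seq bool])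
    (if (size t == i.1) && (t \in i.2) then cyl t else set0)).
  apply: countable_bigcupT_measurable => [|t]; first exact: (countableP [set: seq bool]).
  by case: ifP => // _; exact: measurable_cyl.
apply/seteqP; split=> x.
  by move=> h; exists (pref x i.1) => //; rewrite size_pref eqxx h /cyl/= size_pref.
by case=> t _; case: ifP => // /andP[/eqP st ti]; rewrite /cyl /coded/= -st => ->.
Qed.

(** For each set determined by a prefix and each precision, one member of K that
close to it is selected, provided that there is one. Any other member of K with
the same closeness is then close to the selected one. *)
Lemma countable_approx d (Y : measurableType d) (nu : probability Y R)
    (K : set (set Y)) : cantor_retract Y -> K `<=` measurable -> K !=set0 ->
  exists B : nat -> set Y, (forall n, K (B n)) /\
    forall A, K A -> forall k, exists n, (nu (A `+` B n) <= (2 ^- k)%:E)%E.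
Proof.
move=> [e [r [me mr er]]] mK [B0 KB0].
pose E i := e @^-1` coded i.
have mE i : measurable (E i) by exact: measurable_preimage me (measurable_coded i).
pose good i k B := K B /\ (nu (B `+` E i) <= (2 ^- k)%:E)%E.
pose pick i k : set Y :=
  if pselect (exists B, good i k B) is left h then projT1 (cid h) else B0.
have pickK i k : K (pick i k).
  by rewrite /pick; case: pselect => // h; case: (cid h) => B [].
have pick_good i k B : good i k B -> (nu (pick i k `+` E i) <= (2 ^- k)%:E)%E.
  move=> g; rewrite /pick; case: pselect => [h|[]]; last by exists B.
  by case: (cid h) => B' [].
exists (fun n => if unpickle n is Some (i, k) then pick i k else B0).
split=> [n|A KA k]; first by case: unpickle => // -[].
pose P := law nu me.
have mA := mK _ KA.
have [_ /(_ (2 ^- k.+1))[]] := approximable_measurable P (measurable_preimage mr mA).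
  by rewrite invr_gt0 exprn_gt0.
move=> m [G [fG mG]]; have [i Gi] := prefix_determined_coded fG; rewrite {}Gi in mG * => hi.
have gA : good i k.+1 A.
  split => //; have := ltW hi; rewrite lawE; congr (nu _ <= _)%E.
  by rewrite !setY_def; apply/seteqP; split=> y /=; rewrite er.
exists (pickle (i, k.+1)); rewrite pickleK.
have mp := mK _ (pickK i k.+1).
(* A and the selected member of K are both 2^-(k+1)-close to the same set E i. *)
apply: (@le_trans _ _ (nu (A `+` E i) + nu (pick i k.+1 `+` E i))%E).
  apply: prob_leU; try exact: measurable_setY.
  by rewrite (setYC (pick _ _)); exact: setY_triangle.
rewrite (_ : 2 ^- k = 2 ^- k.+1 + 2 ^- k.+1 :> R).
  by rewrite EFinD; apply: leeD; [exact: gA.2|exact: pick_good gA].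
by rewrite exprS; field; rewrite expf_neq0.
Qed.

End separability.

(** * The maximum T-factor algebra *)

(** The [C q] need not be level sets: it is enough that every level set is the union
of some of them. *)
Lemma measurable_of_levels (R : realType) d (Z : measurableType d)
    (C : rat -> set Z) (f : Z -> R) :
  (forall q, measurable (C q)) ->
  (forall z (c : R), f z < c <-> exists2 q : rat, C q z & ratr q < c) ->
  measurable_fun setT f.
Proof.
move=> mC fC; apply: (@measurability _ _ Z R setT f (@RGenInftyO.G R)).
  exact: RGenInftyO.measurableE.
move=> _ [_ [c ->] <-]; rewrite setTI.
rewrite (_ : f @^-1` _ = \bigcup_(q in [set: rat]) (if (ratr q : R) < c then C q else set0)).
  by apply: bigcupT_measurable_rat => q; case: ifP.
apply/seteqP; split=> z; rewrite /preimage/= in_itv/= => h.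
  by have [q Cq qc] := (fC z c).1 h; exists q => //; rewrite qc.
by apply/fC; have [q _] := h; case: ifP => // qc Cq; exists q.
Qed.

(** For almost every y the rationals q with pi y in C q are those above f y, so that
f y is their infimum, a function of pi y. *)
Lemma factor_version (R : realType) dY (Y : measurableType dY)
    (nu : probability Y R) dZ (Z : measurableType dZ) (pi : Y -> Z) (f : Y -> R)
    (C : rat -> set Z) : measurable_fun setT pi ->
  (forall y, 0 <= f y <= 1) -> (forall q, measurable (C q)) ->
  (forall q, {ae nu, forall y, f y < ratr q <-> C q (pi y)}) ->
  exists f0 : Z -> R, [/\ measurable_fun setT f0, forall z, 0 <= f0 z &
    {ae nu, forall y, f0 (pi y) = f y}].
Proof.
move=> mpi f01 mC fC.
(* The element 1 keeps L z nonempty and the condition 0 <= x bounds it below, so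
   that the infimum behaves at every z; neither changes it where C q (pi y) is
   f y < q, because f takes its values in [0, 1]. *)
pose L z : set R := [set x | x = 1 \/ exists2 q : rat, x = ratr q & 0 <= x /\ C q z].
have L0 z : lbound (L z) 0.
  by move=> x [->|[q -> []]].
have iL z : has_inf (L z) by split; [exists 1; left|exists 0].
have inf_ltP z c : inf (L z) < c <-> exists2 x, L z x & x < c.
  split=> [h|[x Lx xc]]; first by have := inf_lt (iL z).1 h; move=> [x]; exists x.
  by apply: le_lt_trans xc; exact: (ge_inf (iL z).2 Lx).
exists (fun z => inf (L z)); split.
- apply: (@measurable_of_levels _ _ _ (fun q : rat =>
    if q == 1 then setT else if 0 <= q then C q else set0)).
    by move=> q; case: ifP => // _; case: ifP.
  move=> z c; split.
    move=> /inf_ltP[x [->|[q -> [q0 Cq]]] xc].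
      by exists 1; [rewrite eqxx|rewrite rmorph1].
    by exists q => //; case: ifP => // _; rewrite -(ler0q R) q0.
  move=> [q]; case: ifP => [/eqP -> _|_].
    by rewrite rmorph1 => c1; apply/inf_ltP; exists 1 => //; left.
  case: ifP => // q0 Cq qc; apply/inf_ltP; exists (ratr q) => //.
  by right; exists q => //; rewrite ler0q.
- by move=> z; apply: lb_le_inf => //; have [] := iL z.
have := ae_forall_count (I := rat) fC; apply: filterS => y hy.
have /andP[f0 f1] := f01 y; apply/eqP; rewrite eq_le; apply/andP; split.
  rewrite leNgt; apply/negP => lt.
  have i1 : inf (L (pi y)) <= 1 by apply: (ge_inf (iL _).2); left.
  have [q] := rat_in_itvoo lt; rewrite in_itv/= => /andP[fq qi].
  have : inf (L (pi y)) <= ratr q.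
    apply: (ge_inf (iL _).2); right; exists q => //; split; first exact: le_trans f0 (ltW fq).
    by apply/hy.
  by rewrite leNgt qi.
apply: lb_le_inf; first by have [] := iL (pi y).
by move=> x [->//|[q -> [_ /hy /ltW]]].
Qed.

(** A conditional probability with respect to the algebra of a factor map may be
constructed as a function on the factor. *)
Lemma cond_prob_pull (R : realType) dW (W : measurableType dW) dZ (Z : measurableType dZ)
    (P : probability W R) (rho : probability Z R) (p : W -> Z) (E : set W) (f0 : Z -> R) :
  measure_preserving P rho p -> measurable E -> measurable_fun setT f0 ->
  (forall z, 0 <= f0 z) ->
  (forall C, measurable C -> (\int[rho]_(z in C) (f0 z)%:E = P (E `&` p @^-1` C))%E) ->
  cond_prob P (g_sigma_algebra_preimage p) E (f0 \o p).
Proof.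
move=> hp mE mf f00 fE.
have int C : measurable C ->
    (\int[P]_(w in p @^-1` C) (f0 (p w))%:E = P (E `&` p @^-1` C))%E.
  by move=> mC; rewrite -(integral_preserving hp mC mf f00) fE.
split.
- move=> B mB; exists (f0 @^-1` B); first exact: measurable_preimage mf mB.
  by rewrite setTI.
- apply/integrableP; split.
    exact/measurable_EFinP/(measurableT_comp mf hp.1).
  under eq_integral do rewrite /= ger0_norm//.
  have := int setT measurableT; rewrite preimage_setT setIT => ->.
  by apply: le_lt_trans (ltry 1); exact: probability_le1.
- by move=> _ [C mC <-]; rewrite setTI; exact: int.
Qed.

Section maximum.
Context (R : realType) dX (X : measurableType dX) (mu : probability X R) (T : X -> X).
Context dY (Y : measurableType dY) (nu : probability Y R) (S : Y -> Y).
Hypothesis hT : dynamical_system mu T.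
Hypothesis hS : dynamical_system nu S.

Lemma T_event_setT : T_event mu T nu S setT.
Proof.
have [_ [mT _] _] := hT; have [_ [mS _] pS] := hS.
split; first exact: measurableT.
(* The whole space is already visible in the empty family of copies of T, whose
   joining with S is S itself up to isomorphism. *)
pose emb (y : Y) : power void X * Y := ((fun i : void => match i with end), y).
have memb : measurable_fun setT emb.
  by apply: measurable_fun_pair => //; apply: measurable_power => -[].
exists void, (law nu memb), setT; split; first last.
- exact: aeW.
- exact: measurableT.
split=> [[]||].
- by apply: preserving_law; [exact: measurable_snd|exact: preserving_id].
- have h : measure_preserving nu (law nu memb) (emb \o S).
    exact: (preserving_comp pS (law_preserving nu memb)).
  apply: preserving_law.
      by apply: measurable_prod_map; [exact: measurable_power_map|exact: mS].
  rewrite (_ : _ \o emb = emb \o S)//.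
  by apply/funext => y; rewrite /prod_map/=; congr (_, _); apply/funext => -[].
Qed.

Lemma T_factor_algebra_event (F : set (set Y)) A :
  T_factor_algebra mu T nu S F -> F A -> T_event mu T nu S A.
Proof.
move=> [dZ [Z [rho [U [pi [[hU _ [I [lambda [hl [phi hphi]]]]] hpi ->]]]]]].
move=> [C mC <-]; rewrite setTI.
exact: (factor_T_event hT hS hU hpi hl hphi).
Qed.

(** F is chosen to contain countably many T-events approximating all the others. A
T-event is the upper limit of fast approximants, and F is closed under upper
limits. *)
Lemma max_T_factor_algebra_ex : exists F, max_T_factor_algebra mu T nu S F.
Proof.
have rY : cantor_retract Y by have [/standard_borel_retract] := hS.
have mK : T_event mu T nu S `<=` measurable by move=> A [].
have [B [hB approx]] := countable_approx nu rY mK (ex_intro _ _ T_event_setT).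
have [F [hF FB]] := factor_of_events hT hS hB.
exists F; split => // G hG A GA.
have eA := T_factor_algebra_event hG GA.
have [n hn] := choice (approx _ eA).
have mB k : measurable (B (n k)) by exact: mK (hB _).
exists (lim_sup_set (fun k => B (n k))); last exact: limsup_approx (mK _ eA) mB hn.
have [dZ [Z [rho [U [pi [_ [[mpi _] _] FE]]]]]] := hF; rewrite FE in FB *.
have /choice[C hC] k : exists C, measurable C /\ B (n k) = pi @^-1` C.
  by have [C mC <-] := FB (n k); exists C; rewrite setTI.
exists (lim_sup_set C).
  by apply: bigcapT_measurable => k; apply: bigcup_measurable => j _; have [] := hC j.
rewrite setTI /lim_sup_set preimage_bigcap; apply: eq_bigcapr => k _.
by rewrite preimage_bigcup; apply: eq_bigcupr => j _; have [_ ->] := hC j.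
Qed.

(** The conditional probability f of A given Y has all its rational level sets in
F modulo nu, hence factors almost everywhere through Z as f0. It remains to
multiply by the conditional probability g0 of B given Z. *)
Lemma max_T_factor_cond_independent (F : set (set Y)) :
  max_T_factor_algebra mu T nu S F ->
  forall lam : probability (X * Y)%type R, joining mu T nu S lam ->
  cond_independent lam (preimage_set_system setT (@fst X Y) measurable)
    (preimage_set_system setT (@snd X Y) measurable)
    (preimage_set_system setT (@snd X Y) F).
Proof.
move=> [[dZ [Z [rho [U [pi [_ [hpi _] FE]]]]]] maxF] lam jlam.
move=> _ _ [A mA <-] [B mB <-]; rewrite !setTI.
have [_ lY _] := jlam.
have [f [mf f01 fint fev]] := cond_prob_events hT hS jlam mA.
(* One T-factor algebra contains all rational level sets of f, and F contains it
   modulo nu. *)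
pose L n := if unpickle n is Some q then [set y | f y < ratr (q : rat)] else setT.
have hL n : T_event mu T nu S (L n).
  by rewrite /L; case: unpickle => [q|]; [exact: fev|exact: T_event_setT].
have [G [hG GL]] := factor_of_events hT hS hL.
have /choice[C hC] (q : rat) : exists C, measurable C /\
    {ae nu, forall y, f y < ratr q <-> C (pi y)}.
  have [B' FB' nB'] := maxF G hG _ (GL (pickle q)).
  move: FB'; rewrite FE => -[C mC]; rewrite setTI => CB'; exists C; split => //.
  have mL : measurable (L (pickle q)) by have [] := hL (pickle q).
  exists (L (pickle q) `+` B'); split => //.
    by apply: measurable_setY => //; rewrite -CB'; exact: measurable_preimage hpi.1 mC.
  move=> y hy; rewrite setY_def /L pickleK -CB' /=.
  have [fq|nfq] := pselect (f y < ratr q).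
    by left; split => // Cy; apply: hy.
  right; split => //; apply: contrapT => nC; apply: hy.
  by split.
(* Since f is a version of P(A | Y), so is f0 o pi; being measurable with respect
   to F, it is then also a version of P(A | F). *)
have [f0 [mf0 f00 f0f]] := factor_version hpi.1 f01 (fun q => (hC q).1) (fun q => (hC q).2).
have [g0 [mg0 g00 _ gE gM]] := cond_density hpi mB.
have hp := preserving_comp lY hpi.
have mfst := @measurable_fst _ _ X Y; have msnd := @measurable_snd _ _ X Y.
have int_f D : measurable D -> (\int[nu]_(y in D) (f0 (pi y))%:E = lam (A `*` D))%E.
  move=> mD; rewrite -fint//; apply: ge0_ae_eq_integral => //.
  - exact/measurable_EFinP/measurable_funTS/(measurableT_comp mf0 hpi.1).
  - exact/measurable_EFinP/measurable_funTS.
  - by move=> y _; rewrite lee_fin.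
  - by move=> y _; rewrite lee_fin; have /andP[] := f01 y.
  - by apply: filterS f0f => y -> _.
have -> : preimage_set_system setT (@snd X Y) F = g_sigma_algebra_preimage (pi \o snd).
  rewrite FE; apply/seteqP; split=> [_ [_ [D mD <-] <-]|_ [D mD <-]].
    by exists D; rewrite // !setTI.
  by exists (pi @^-1` D); [exists D; rewrite // setTI|rewrite !setTI].
exists (f0 \o (pi \o snd)), (g0 \o (pi \o snd)), ((f0 \* g0) \o (pi \o snd)).
split.
- apply: (cond_prob_pull hp) => //; first exact: measurable_preimage mfst mA.
  move=> D mD; rewrite (integral_preserving hpi mD mf0 f00).
  exact: (int_f _ (measurable_preimage hpi.1 mD)).
- apply: (cond_prob_pull hp) => //; first exact: measurable_preimage msnd mB.
  move=> D mD; rewrite gE//; apply/esym.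
  exact: (lY.2 _ (measurableI _ _ mB (measurable_preimage hpi.1 mD))).
- apply: (cond_prob_pull hp).
  + by apply: measurableI; [exact: measurable_preimage mfst mA|exact: measurable_preimage msnd mB].
  + exact: measurable_funM.
  + by move=> z; exact: mulr_ge0.
  (* The integral of f0 g0 over D is that of f0 o pi over the intersection of B with
   the preimage of D, and f0 o pi is a version of P(A | Y). *)
  move=> D mD; rewrite gM// int_f; last first.
    by apply: measurableI => //; exact: measurable_preimage hpi.1 mD.
  by congr (lam _); apply/seteqP; split=> -[x y] /=; tauto.
- exact: aeW.
Qed.

End maximum.

Theorem theorem3p7 (R : realType) (dX dY : measure_display)
    (X : measurableType dX) (mu : probability X R) (T : X -> X)
    (Y : measurableType dY) (nu : probability Y R) (S : Y -> Y)
    (hT : dynamical_system mu T) (hS : dynamical_system nu S) :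
  (exists F : set (set Y), max_T_factor_algebra mu T nu S F) /\
  (forall (F : set (set Y)), max_T_factor_algebra mu T nu S F ->
   forall lambda : probability (X * Y)%type R,
     joining mu T nu S lambda ->
     cond_independent lambda
       (preimage_set_system setT (@fst X Y) measurable)
       (preimage_set_system setT (@snd X Y) measurable)
       (preimage_set_system setT (@snd X Y) F)).
Proof.
split; first exact: max_T_factor_algebra_ex.
exact: max_T_factor_cond_independent.
Qed.
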